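(* Let $k$ be an algebraically closed field of positive characteristic, and let $\mathfrak m=(X_1,\dots,X_N)$ be the maximal ideal defining the origin $0\in\mathbb{A}_k^N$. Then for every pair $(\mathbb{A}_k^N,\mathfrak a)\in\mathcal L_k$ with $\mathfrak a$ an $\mathfrak m$-primary ideal, there exists a prime divisor over $\mathbb{A}_k^N$ computing $\mathrm{lct}(0;\mathbb{A}_k^N,\mathfrak a)$.
   Context: Let $A=\mathbb{A}_k^N=\operatorname{Spec}k[X_1,\dots,X_N]$, $N\ge 1$. A prime divisor $E$ over $A$ is a prime divisor on some normal $A'$ with a birational morphism $A'\to A$; $\mathrm{val}_E$ is the corresponding valuation and $k_E$ is the coefficient at $E$ of the relative canonical divisor $K_{A'/A}$. For a nonzero ideal $\mathfrak a$ of $k[X_1,\dots,X_N]$, the log canonical threshold at the origin is $$\mathrm{lct}(0;A,\mathfrak a)=\sup\{r\in\mathbb{R}_{\ge0}\mid (A,\mathfrak a^r)\text{ is log canonical at }0\}=\inf_E\frac{k_E+1}{\mathrm{val}_E(\mathfrak a)},$$ where $E$ runs over prime divisors over $A$ whose center contains $0$. Such an $E$ computes $\mathrm{lct}(0;A,\mathfrak a)$ if $\frac{k_E+1}{\mathrm{val}_E(\mathfrak a)}=\mathrm{lct}(0;A,\mathfrak a)$. A prime divisor $E$ over $\mathbb{A}_k^N$ is a toric prime divisor if there is $w\in\mathbb{Z}_{\ge0}^N$ such that $\mathrm{val}_E(f)=\min\{\sum_i w_iu_i\mid X^u \text{ appears in } f \text{ with nonzero coefficient}\}$ for all polynomials $f$.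 We say $\mathrm{lct}(0;\mathbb{A}_k^N,\mathfrak a)$ has a toric approximation if for every $\epsilon>0$ there is a toric prime divisor $E_\epsilon$ over $\mathbb{A}_k^N$ with $\left|\frac{k_{E_\epsilon}+1}{\mathrm{val}_{E_\epsilon}\mathfrak a}-\mathrm{lct}(0;\mathbb{A}_k^N,\mathfrak a)\right|<\epsilon$. $\mathcal L_k$ is the set of pairs $(\mathbb{A}_k^N,\mathfrak a)$, $N\ge1$, such that $\mathrm{lct}(0;\mathbb{A}_k^N,\mathfrak a)$ has a toric approximation. *)

(* Defs.v *)
From HB Require Import structures.
From mathcomp Require Import all_boot all_order all_algebra.
From mathcomp Require Import mpoly ring.
From mathcomp Require Import boolp classical_sets reals constructive_ereal ereal.

Set Implicit Arguments.
Unset Strict Implicit.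
Unset Printing Implicit Defensive.

Import Order.TTheory GRing.Theory Num.Theory.

Local Open Scope classical_set_scope.
Local Open Scope ring_scope.
Local Open Scope quotient_scope.

(* The function field k(X_1, ..., X_N) of affine N-space. *)
Notation ratfun k N := {fraction {mpoly k[N]}}.

Notation "p %:F" := (FracField.tofrac p) : ring_scope.

(* Subrings and their ideals are sets in an ambient ring: ideals of k[X] have
   B = setT, ideals of a chart have B a subring of k(X). *)
Definition is_ideal (R : comNzRingType) (B I : set R) : Prop :=
  [/\ I `<=` B, I 0, (forall x y, I x -> I y -> I (x + y)) &
      forall b x, B b -> I x -> I (b * x)].

Definition is_prime (R : comNzRingType) (B P : set R) : Prop :=
  [/\ is_ideal B P, ~ P 1 &
      forall x y, B x -> B y -> P (x * y) -> P x \/ P y].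

Definition height_one (R : comNzRingType) (B P : set R) : Prop :=
  [/\ is_prime B P, P <> [set 0] &
      forall Q, is_prime B Q -> Q `<=` P -> Q = [set 0] \/ Q = P].

Definition radical (R : comNzRingType) (I : set R) : set R :=
  [set x | exists n : nat, I (x ^+ n)].

Definition primary_to (R : comNzRingType) (M I : set R) : Prop :=
  [/\ is_ideal setT I, ~ I 1,
      (forall x y, I (x * y) -> I x \/ exists n : nat, I (y ^+ n)) &
      radical I = M].

(* The subalgebra k[g_1, ..., g_n] of k(X_1, ..., X_N). *)
Definition generated_by (k : fieldType) (N n : nat) (g : 'I_n -> ratfun k N) :
    set (ratfun k N) :=
  range (fun q : {mpoly k[n]} => mmap (fun c => (c%:MP_[N])%:F) g q).

Definition integrally_closed (K : fieldType) (B : set K) : Prop :=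
  forall x : K,
    (exists p : {poly K}, [/\ p \is monic, (forall i, B p`_i) & root p x]) ->
  B x.

(* A prime divisor over A = A^N_k. Only the generic point of E matters, so the
   normal variety A' is replaced by an affine open subset Spec B meeting E.
   Birationality of A' -> A identifies the function field of A' with
   k(X_1, ..., X_N); hence B is a finitely generated, integrally closed
   k-algebra with k[X] <= B <= k(X), and E is a height one prime of B. *)
Record prime_divisor (k : fieldType) (N : nat) := PrimeDivisor {
  chart : set (ratfun k N);
  chart_fg : exists (n : nat) (g : 'I_n -> ratfun k N), chart = generated_by g;
  chart_over : forall f : {mpoly k[N]}, chart f%:F;
  chart_normal : integrally_closed chart;
  div_prime : set (ratfun k N);
  div_primeP : height_one chart div_prime }.

Section PrimeDivisor.
Context (k : fieldType) (N : nat).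
Implicit Types (E : prime_divisor k N) (f t u x : ratfun k N).

(* The local ring O_{A',E} and its maximal ideal. *)
Definition local_ring E : set (ratfun k N) :=
  [set x | exists a b,
     [/\ chart E a, chart E b, ~ div_prime E b & x = a / b]].

Definition local_max E : set (ratfun k N) :=
  [set x | exists a b,
     [/\ div_prime E a, chart E b, ~ div_prime E b & x = a / b]].

Definition is_uniformizer E t : Prop :=
  local_max E = [set c * t | c in local_ring E].

Definition is_local_unit E u : Prop :=
  [/\ u != 0, local_ring E u & local_ring E u^-1].

Definition has_val E f (n : int) : Prop :=
  exists t u, [/\ is_uniformizer E t, is_local_unit E u & f = u * t ^ n].

(* val_E on k(X)^*; the value at 0 is a dummy and is never used. *)
Definition val E f : int := xget 0 [set n | has_val E f n].

(* The partial derivative with respect to X_i, extended to k(X) by the quotient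
   rule; see fpartialE for the independence of the representative. *)
Definition fpartial (i : 'I_N) x : ratfun k N :=
  let: n := \n_(repr x) in let: d := \d_(repr x) in
  (n^`M(i) * d - n * d^`M(i))%:F / (d ^+ 2)%:F.

(* dg_1 /\ ... /\ dg_N = (jacobian g) dX_1 /\ ... /\ dX_N. *)
Definition jacobian (g : 'I_N -> ratfun k N) : ratfun k N :=
  \det (\matrix_(i, j) fpartial j (g i)).

(* dg_1 /\ ... /\ dg_N generates the stalk of omega_{A'} at the generic point
   of E, i.e. the O_{A',E}-module of N-forms spanned by the
   dh_1 /\ ... /\ dh_N with h_i in O_{A',E}. *)
Definition generates_canonical E (g : 'I_N -> ratfun k N) : Prop :=
  [/\ (forall i, local_ring E (g i)), jacobian g != 0 &
      forall h : 'I_N -> ratfun k N, (forall i, local_ring E (h i)) ->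
        exists2 c, local_ring E c & jacobian h = c * jacobian g].

(* k_E. As dX_1 /\ ... /\ dX_N generates omega_A, K_{A'/A} is the divisor of
   this form on A', and the form is (jacobian g)^-1 times the local generator
   dg_1 /\ ... /\ dg_N. *)
Definition discrepancy E : int :=
  xget 0 [set n | exists2 g, generates_canonical E g &
                             n = val E (jacobian g)^-1].

Definition is_least (S : set int) (n : int) : Prop :=
  S n /\ forall m, S m -> n <= m.

Implicit Types a : set {mpoly k[N]}.

Definition ideal_val E a : int :=
  xget 0 [set n |
    is_least [set val E f%:F | f in [set f | a f /\ f != 0]] n].

(* The maximal ideal (X_1, ..., X_N) of the origin. *)
Definition origin_ideal : set {mpoly k[N]} :=
  range (fun c : 'I_N -> {mpoly k[N]} => \sum_(i < N) c i * 'X_i).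

(* The center of E is the closed set of the prime ideal P_E /\ k[X]. *)
Definition center_contains_origin E : Prop :=
  [set f : {mpoly k[N]} | div_prime E f%:F] `<=` origin_ideal.

Definition is_toric E : Prop :=
  exists w : 'I_N -> nat, forall f : {mpoly k[N]}, f != 0 ->
    is_least [set (\sum_(i < N) w i * u i)%:Z | u in [set` msupp f]]
             (val E f%:F).

Section Threshold.
Context (R : realType).

(* (k_E + 1) / val_E(a), equal to +oo when val_E(a) = 0. *)
Definition lct_ratio E a : \bar R :=
  if ideal_val E a == 0 then +oo%E
  else ((discrepancy E + 1)%:~R / (ideal_val E a)%:~R)%:E.

Definition lc_at_origin a (r : R) : Prop :=
  forall E, center_contains_origin E ->
    -1 <= (discrepancy E)%:~R - r * (ideal_val E a)%:~R.

Definition lct a : \bar R :=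
  ereal_sup [set r%:E | r in [set r : R | 0 <= r /\ lc_at_origin a r]].

Definition computes_lct E a : Prop :=
  center_contains_origin E /\ lct_ratio E a = lct a.

Definition toric_approximation a : Prop :=
  forall e : R, 0 < e ->
    exists2 E, is_toric E & (`| lct_ratio E a - lct a | < e%:E)%E.

End Threshold.
End PrimeDivisor.

(* The pair (A^N_k, a) belongs to the class L_k. *)
Definition classL (R : realType) (k : fieldType) (N : nat)
    (a : set {mpoly k[N]}) : Prop :=
  [/\ (0 < N)%N, is_ideal setT a, (exists2 f, a f & f != 0) &
      toric_approximation R a].

Section Facts.
Fact unit_uniformizer_inv (K : fieldType) (u t : K) m : u != 0 -> t != 0 ->
  u^-1 * (u / t ^+ m.+1) * t ^+ m * t = 1.
Proof.
by move=> u0 t0; rewrite mulKf // -mulrA -exprSr mulVf // expf_neq0.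
Qed.

Context (k : fieldType) (N : nat).
Implicit Types (E : prime_divisor k N) (p q : {mpoly k[N]}).

Lemma fpartialE (i : 'I_N) p q : q != 0 ->
  fpartial i (p%:F / q%:F) = (p^`M(i) * q - p * q^`M(i))%:F / (q ^+ 2)%:F.
Proof.
move=> q0; rewrite /fpartial.
set x := p%:F / q%:F; set n := (frac (repr x)).1; set d := (frac (repr x)).2.
have d0 : d != 0 by exact: denom_ratioP.
have xE : x * d%:F = n%:F.
  rewrite -[x in LHS]reprK /n /d.
  case: (repr x) => -[n' d'] /= h; unlock FracField.tofrac.
  rewrite -[LHS]FracField.pi_mul; apply/eqmodP.
  rewrite /= FracField.equivfE /FracField.mulf /= !numden_Ratio ?oner_neq0
    ?mulr1 //=.
  by rewrite mulrC.
have e : p * d = n * q.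
  by apply/eqP; rewrite -tofrac_eq !tofracM -xE mulrAC divfK // tofrac_eq0.
have e' : p^`M(i) * d + p * d^`M(i) = n^`M(i) * q + n * q^`M(i).
  by rewrite -!mderivM e.
apply/eqP; rewrite GRing.eqr_div ?tofrac_eq0 ?expf_neq0 // -!tofracM tofrac_eq.
move/eqP: e'; rewrite -subr_eq => /eqP e'.
apply/eqP; transitivity (n^`M(i) * q * (d * q) - n * q * (d^`M(i) * q)); first by ring.
rewrite -e'.
transitivity (p^`M(i) * d * (d * q) + p * d^`M(i) * (d * q) - (n * q) * (q^`M(i) * d) - n * q * (d^`M(i) * q)); first by ring.
by rewrite -e; ring.
Qed.

Lemma generated_byM n (g : 'I_n -> ratfun k N) x y :
  generated_by g x -> generated_by g y -> generated_by g (x * y).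
Proof.
move=> [p _ <-] [q _ <-]; exists (p * q) => //.
exact: (rmorphM (mmap (@FracField.tofrac _ \o @mpolyC N k) g)).
Qed.

Lemma jacobianX : jacobian (fun i : 'I_N => ('X_i : {mpoly k[N]})%:F) = 1.
Proof.
rewrite -[RHS](det1 (ratfun k N) N); congr (\det _).
apply/matrixP => i j; rewrite !mxE.
rewrite -[_%:F]divr1 -tofrac1 fpartialE ?oner_neq0 //.
rewrite expr1n mulr1 -[1]/(mpolyC N 1) mderivC mulr0 subr0 mderivX mnm1E.
have [->|_] := eqVneq i j; last by rewrite scale0r tofrac0 mul0r.
by rewrite (_ : (U_(j) - U_(j) = 0)%MM) ?mpolyX0 ?eqxx ?scale1r ?tofrac1 ?divr1 //;
  apply/mnmP => l; rewrite mnmBE subnn mnm0E.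
Qed.

Lemma local_ringM E x y : local_ring E x -> local_ring E y ->
  local_ring E (x * y).
Proof.
have [n [g cE]] := chart_fg E.
have cM u v : chart E u -> chart E v -> chart E (u * v).
  by rewrite cE; exact: generated_byM.
have [[_ _ dP] _ _] := div_primeP E.
move=> [a [b [a1 b1 b2 ->]]] [c [d [c1 d1 d2 ->]]].
exists (a * c), (b * d); split; [exact: cM | exact: cM | | by rewrite mulf_div].
by case/(dP _ _ b1 d1).
Qed.

Lemma not_local_max1 E : ~ local_max E 1.
Proof.
move=> [a [b [a1 b1 b2 /esym]]].
have [[[_ P0 _ _] _ _] _ _] := div_primeP E.
have b0 : b != 0 by apply/eqP => b0; apply: b2; rewrite b0.
by move/(divr1_eq) => ab; apply: b2; rewrite -ab.
Qed.

Lemma has_val_ge0 E x n : x != 0 -> local_ring E x -> has_val E x n -> 0 <= n.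
Proof.
move=> x0 Ex [t [u [tE [u0 Eu Eu']] xE]]; case: n xE => // m xE; exfalso.
have {}xE : x = u / t ^+ m.+1 := xE.
have t0 : t != 0 by apply: contraNneq x0 => t0; rewrite xE t0 expr0n invr0 mulr0.
have tO : local_ring E t.
  have [a [b [a1 b1 b2 tab]]] : local_max E t.
    rewrite tE; exists 1; last by rewrite mul1r.
    have [[[_ P0 _ _] P1 _] _ _] := div_primeP E.
    have c1 : chart E 1 by rewrite -(tofrac1 {mpoly k[N]}); exact: chart_over.
    by exists 1, 1; split; rewrite // divr1.
  have [[[PB _ _ _] _ _] _ _] := div_primeP E.
  by exists a, b; split => //; exact: PB.
apply: (@not_local_max1 E); rewrite tE.
have tmO : local_ring E (t ^+ m).
  elim: m {xE} => [|m IH]; last by rewrite exprS; exact: local_ringM.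
  by rewrite expr0 -(divff u0); exact: local_ringM.
exists (u^-1 * x * t ^+ m); first by do 2!apply: local_ringM => //.
by rewrite xE; exact: unit_uniformizer_inv.
Qed.

Lemma val_ge0 E x : x != 0 -> local_ring E x -> 0 <= val E x.
Proof.
by move=> x0 Ex; rewrite /val; case: xgetP => // n _; exact: has_val_ge0.
Qed.

Lemma local_ring_poly E p : local_ring E p%:F.
Proof.
exists p%:F, 1; rewrite divr1; split => //; first exact: chart_over.
  by rewrite -(tofrac1 {mpoly k[N]}); exact: chart_over.
by have [[_ P1 _] _ _] := div_primeP E.
Qed.

Lemma discrepancy_ge0 E : 0 <= discrepancy E.
Proof.
rewrite /discrepancy; case: xgetP => // n _ [g [_ g0 gE] ->].
have [i|c Ec] := gE (fun i => ('X_i : {mpoly k[N]})%:F).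
  exact: local_ring_poly.
rewrite jacobianX => /esym cg; apply: val_ge0; first by rewrite invr_eq0.
by rewrite -[_^-1]mul1r -cg mulfK.
Qed.

Lemma ideal_val_ge0 E (a : set {mpoly k[N]}) : 0 <= ideal_val E a.
Proof.
rewrite /ideal_val; case: xgetP => // n _ [[f [_ f0] <-] _].
by apply: val_ge0; rewrite ?tofrac_eq0 //; exact: local_ring_poly.
Qed.

Lemma lct_inf (R : realType) (a : set {mpoly k[N]}) :
  lct R a = ereal_inf [set lct_ratio R E a | E in center_contains_origin (N := N)].
Proof.
have rle E (r : R) : -1 <= (discrepancy E)%:~R - r * (ideal_val E a)%:~R <->
    (r%:E <= lct_ratio R E a)%E.
  have v0 := ideal_val_ge0 E a; have d0 := discrepancy_ge0 E.
  rewrite /lct_ratio lerBrDr addrC lerBlDr; case: eqVneq => [->|vn0].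
    rewrite mulr0z mulr0 leey; split=> // _.
    by rewrite addr_ge0 // ler0z.
  rewrite lee_fin ler_pdivlMr; last by rewrite ltr0z lt_def vn0.
  by rewrite intrD.
apply/eqP; rewrite eq_le; apply/andP; split.
  apply: ge_ereal_sup => _ [r [_ ra] <-]; apply: le_ereal_inf_tmp => _ [E cE <-].
  by apply/rle; exact: ra.
set l := ereal_inf _.
have l0 : (0%:E <= l)%E.
  apply: le_ereal_inf_tmp => _ [E cE <-]; apply/rle.
  rewrite mul0r subr0 (@le_trans _ _ 0) ?lerN10 // ler0z.
  exact: discrepancy_ge0.
have lc (r : R) : 0 <= r -> (r%:E <= l)%E -> (r%:E <= lct R a)%E.
  move=> r0 rl; apply: ereal_sup_ubound; exists r => //; split => // E cE.
  by apply/rle; apply: (le_trans rl); apply: ereal_inf_lbound; exists E.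
case: l l0 lc => [r l0 lc|_ lc|//]; first exact: lc.
rewrite leye_eq; apply/eqP; apply/eqyP => r r0; apply: lc; first exact: ltW.
by rewrite leey.
Qed.
End Facts.

(* Main.v *)
Require Import Defs.
From HB Require Import structures.
From mathcomp Require Import all_boot all_order all_algebra.
From mathcomp Require Import perm mpoly ring lra zify.
From mathcomp Require Import boolp classical_sets reals constructive_ereal ereal.

Set Implicit Arguments.
Unset Strict Implicit.
Unset Printing Implicit Defensive.

Import Order.TTheory GRing.Theory Num.Theory.

Local Open Scope classical_set_scope.
Local Open Scope ring_scope.

(* For a toric divisor of weight w one has k_E + 1 = sum w_i and val_E(a) is the
   least w-weight of a monomial occurring in a, so the infimum of
   (k_E + 1) / val_E(a) over toric divisors is the value of a linear program over
   Q. As a contains a power of every variable, only finitely many exponents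
   matter, so the optimum is attained at a rational w, which may be scaled to a
   primitive integral one. The ring k[X^u : w.u >= 0] is then a chart carrying a
   prime divisor E_w with monomial valuation w, and the toric approximation
   forces its ratio to be the log canonical threshold.
   A toric E has the same local ring as E_w, because a uniformizer and height one
   already make O_E a discrete valuation ring. Its discrepancy is read off
   logarithmic derivatives: the weighted Euler field sum w_j X_j d/dX_j maps O_E
   into its maximal ideal, which bounds the Jacobians, and a suitable system of
   monomials reaches the bound. *)

(** The obstacle is attainment: weights whose ratios approach the threshold may converge, after
    scaling, to an irrational direction, which is no divisor. A linear program with rational data
    and finitely many constraints has a rational optimum T, and the primary hypothesis provides the
    finiteness. One inequality is then free: E_w has a center through the origin, so lct is at most
    its ratio, hence at most T. Conversely a toric divisor of finite ratio is a feasible point after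
    scaling, so its ratio is at least T. Positive characteristic shapes the discrepancy computation,
    because entries of w may vanish in k. Primitivity is therefore carried as an integral vector v
    with v.w = 1. It yields the uniformizer X^v, the generators of the chart and an entry w_j that
    is nonzero in k. The exponents of the chart fill a half-space, so that X^v and monomials of
    weight zero generate it. The chart is also the Laurent ring intersected with a valuation ring,
    so its normality reduces to that of k[X], obtained from complete integral closedness by
    induction on the number of variables. *)

(** * Complete integral closedness of polynomial rings *)

(** All powers of f/g share the denominator [d]. Stating this by products inside [D] lets the
    property be transported along ring morphisms. Integral fractions satisfy the premise, see
    [integral_cic]. *)
Definition completely_integrally_closed (D : idomainType) : Prop :=
  forall f g d : D, g != 0 -> d != 0 ->
    (forall m : nat, exists h, d * f ^+ m = h * g ^+ m) -> exists q, f = q * g.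

Section CIC.
Context (D : idomainType) (DC : completely_integrally_closed D).
Implicit Types f g d q : {poly D}.

(** Coefficients are divided by [c] from the top: taking leading coefficients in the hypothesis
    makes [lead_coef q] almost divisible by [c] in [D], and the hypothesis passes to [q] minus its
    leading term. *)
Lemma cic_polyC q d (c : D) : c != 0 -> d != 0 ->
  (forall m : nat, exists h, d * q ^+ m = c ^+ m *: h) -> exists r, q = c *: r.
Proof.
move=> c0 d0; have [n] := ubnP (size q).
elim: n q => // n IH q; rewrite ltnS => sq qh.
have [->|q0] := eqVneq q 0; first by exists 0; rewrite scaler0.
have [e lqE] : exists e, lead_coef q = e * c.
  apply: (DC (d := lead_coef d)) => //; first by rewrite lead_coef_eq0.
  move=> m; have [h] := qh m => /(congr1 lead_coef).
  by rewrite lead_coefM lead_coef_exp lead_coefZ => ->;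
    exists (lead_coef h); rewrite mulrC.
pose s := (size q).-1; pose q1 := q - c *: (e *: 'X^s).
have [||r q1E] := IH q1.
- rewrite (leq_trans _ sq) //.
  have -> : size q = s.+1 by rewrite prednK // lt0n size_poly_eq0.
  rewrite ltnS; apply/leq_sizeP => j; rewrite leq_eqVlt => /orP[/eqP <-|sj].
    by rewrite coefB !coefZ coefXn eqxx mulr1 mulrC -lqE /lead_coef subrr.
  rewrite coefB !coefZ coefXn gtn_eqF // !mulr0 subr0 nth_default //.
  by rewrite -(prednK (n := size q)) // lt0n size_poly_eq0.
(* The induction on [m] needs the mixed products, because each factor [q1] is [q] minus a multiple
   of [c]. *)
- suff P m i : exists h, d * q ^+ i * q1 ^+ m = c ^+ (i + m) *: h.
    by move=> m; have [h] := P m 0; rewrite mulr1 add0n; exists h.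
  elim: m i => [|m IHm] i; first by rewrite mulr1 addn0; exact: qh.
  have [h1 h1E] := IHm i.+1; have [h2 h2E] := IHm i.
  exists (h1 - e *: 'X^s * h2).
  have -> : d * q ^+ i * q1 ^+ m.+1 =
    d * q ^+ i.+1 * q1 ^+ m - c *: (e *: 'X^s) * (d * q ^+ i * q1 ^+ m).
    rewrite !exprS [q1 * _]mulrBl; move: (q1 ^+ m) (q ^+ i) (c *: _) => *.
    by ring.
  by rewrite h1E h2E addnS addSn exprS -!mul_polyC polyCM; ring.
- by exists (r + e *: 'X^s); rewrite scalerDr -q1E subrK.
Qed.

(** The cofactors [f'] and [g'] of the gcd are coprime over the fraction field of [D], so powers of
    [g'] divide [d] there and [g'] must be a constant. This constant and a scalar of pseudo-division
    make up [c]. *)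
Lemma cic_frac f g d : g != 0 -> d != 0 ->
    (forall m : nat, exists h, d * f ^+ m = h * g ^+ m) ->
  exists c q, c != 0 /\ c *: f = q * g.
Proof.
move=> g0 d0 dh.
pose e := gcdp f g.
have e0 : e != 0 by rewrite gcdp_eq0 negb_and g0 orbT.
have /Pdiv.Idomain.divpK := dvdp_gcdl f g; rewrite -/e.
set c1 := _ ^+ _; set f' : {poly D} := f %/ e => fE.
have /Pdiv.Idomain.divpK := dvdp_gcdr f g; rewrite -/e.
set c2 := _ ^+ _; set g' : {poly D} := g %/ e => gE.
have c10 : c1 != 0 by rewrite expf_neq0 // lead_coef_eq0.
have c20 : c2 != 0 by rewrite expf_neq0 // lead_coef_eq0.
have co : coprimep f' g' by apply: coprimep_div_gcd; rewrite g0 orbT.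
have g'0 : g' != 0.
  apply/eqP => g'0; move: gE => /esym/eqP; rewrite g'0 mul0r -mul_polyC mulf_eq0.
  by rewrite polyC_eq0 (negPf c20) (negPf g0).
(* The exponent [size d] exceeds the degree of [d], so a power of [g'] with this exponent divides
   [d] only if [g'] has degree 0. *)
have [h hE] := dh (size d).
have hE' : c2 ^+ size d *: (d * f' ^+ size d) = (c1 ^+ size d *: h) * g' ^+ size d.
  apply: (mulIf (expf_neq0 (size d) e0)).
  rewrite -scalerAl -!mulrA -!exprMn fE gE.
  rewrite !exprZn -scalerAr hE -!mul_polyC.
  by ring.
have gd : g' ^+ size d %| d.
  rewrite -(@Pdiv.Idomain.Gauss_dvdpl _ d (f' ^+ size d)); last first.
    by rewrite coprimep_sym coprimep_expl // coprimep_expr.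
  apply/Pdiv.Idomain.dvdpP; exists (c2 ^+ size d, c1 ^+ size d *: h) => //=.
  exact: expf_neq0.
have sg : size g' = 1%N.
  have := dvdp_leq d0 gd; have := size_exp g' (size d).
  have : (0 < size d)%N by rewrite lt0n size_poly_eq0.
  have : (0 < size g')%N by rewrite lt0n size_poly_eq0.
  have : (0 < size (g' ^+ size d))%N by rewrite lt0n size_poly_eq0 expf_neq0.
  case: (size g') => [|[|x]] //; nia.
have /size_poly1P[b b0 g'E] : size g' == 1%N by rewrite sg.
exists (b * c1), (c2 *: f'); split; first by rewrite mulf_neq0.
rewrite -scalerA -fE -[RHS]scalerAl [RHS]scalerAr -gE g'E -mul_polyC.
by ring.
Qed.

Lemma cic_poly : completely_integrally_closed {poly D}.
Proof.
move=> f g d g0 d0 dh; have [c [q [c0 cf]]] := cic_frac g0 d0 dh.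
have [|r qE] := cic_polyC (q := q) c0 d0.
  move=> m; have [h hE] := dh m; exists h.
  apply: (mulIf (expf_neq0 m g0)); rewrite -mulrA -exprMn -cf exprZn.
  by rewrite -scalerAr hE scalerAl.
have cP0 : c%:P != 0 by rewrite polyC_eq0.
exists r; apply: (mulfI cP0).
by rewrite mul_polyC cf qE -mul_polyC mulrA.
Qed.
End CIC.

Lemma cic_rmorph (D D' : idomainType) (h : {rmorphism D -> D'})
  (h' : {rmorphism D' -> D}) : cancel h h' ->
  completely_integrally_closed D' -> completely_integrally_closed D.
Proof.
move=> hK C f g d g0 d0 dh.
have [|||q fE] := C (h f) (h g) (h d).
- by rewrite -(rmorph0 h) (can_eq hK).
- by rewrite -(rmorph0 h) (can_eq hK).
- by move=> m; have [x xE] := dh m; exists (h x); rewrite -!rmorphXn -!rmorphM xE.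
- by exists (h' q); rewrite -[f]hK fE rmorphM hK.
Qed.

Lemma cic_mpoly (k : fieldType) (N : nat) :
  completely_integrally_closed {mpoly k[N]}.
Proof.
elim: N => [|N IH].
  move=> f g d g0 _ _; exists (f * (g@_0%MM)^-1%:MP).
  rewrite -mulrA [in X in _ * X](nvar0_mpolyC g) mpolyCK -mpolyCM mulVf ?mulr1 //.
  by apply: contraNneq g0 => g0; rewrite (nvar0_mpolyC g) g0 mpolyC0.
(* [ev] widens the coefficients and puts the last variable back: a left inverse of [muni]. *)
pose ev : {rmorphism {poly {mpoly k[N]}} -> {mpoly k[N.+1]}} :=
  horner_eval ('X_(@ord_max N) : {mpoly k[N.+1]}) \o
   map_poly (@mwiden N k).
apply: (@cic_rmorph _ _ (@muni N k) ev _ (cic_poly IH)) => p.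
change (ev (muni p) = p).
rewrite muniE rmorph_sum [RHS]mpolyE; apply: eq_bigr => m _.
rewrite /ev /= map_polyZ map_polyXn /horner_eval hornerZ hornerXn.
rewrite [X in X * _](mwidenZ p@_m) mwidenX.
rewrite -scalerAl mpolyXn -mpolyXD; congr (_ *: 'X_[_]).
apply/mnmP => i; rewrite mnmDE mulmnE mnm1E.
case: (unliftP ord_max i) => [j|] ->; last by rewrite mnmwiden_ordmax eqxx mul1n.
have -> : lift ord_max j = widen_ord (leqnSn N) j.
  by apply: val_inj; rewrite /= /bump leqNgt ltn_ord.
rewrite mnmwiden_widen mnmE (_ : _ == _ = false) ?mul0n ?addn0 //.
by apply/negbTE; rewrite -val_eqE /= gtn_eqF.
Qed.

(** * Monomial valuations *)

Section LowestDegree.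
Context (D : idomainType).
Implicit Types p q : {poly D}.

Definition low_deg p : nat := find (fun c => c != 0) p.

Lemma coef_low_deg p : p != 0 -> p`_(low_deg p) != 0.
Proof.
move=> p0; apply: (@nth_find D 0 (fun c => c != 0) p).
apply/hasP; exists (lead_coef p); last by rewrite lead_coef_eq0.
by rewrite mem_nth // prednK // lt0n size_poly_eq0.
Qed.

Lemma coef_lt_low_deg p i : (i < low_deg p)%N -> p`_i = 0.
Proof. by move/(before_find 0)/negbFE/eqP. Qed.

Lemma leq_low_deg p n : p != 0 -> (forall i, (i < n)%N -> p`_i = 0) ->
  (n <= low_deg p)%N.
Proof.
move=> p0 pn; rewrite leqNgt; apply/negP => /pn/eqP.
by apply/negP; exact: coef_low_deg.
Qed.

Lemma coefM_lt p q a b i : (forall j, (j < a)%N -> p`_j = 0) ->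
  (forall j, (j < b)%N -> q`_j = 0) -> (i < a + b)%N -> (p * q)`_i = 0.
Proof.
move=> pa qb iab; rewrite coefM big1 // => j _.
have [/pa ->|aj] := ltnP j a; first by rewrite mul0r.
rewrite qb ?mulr0 //; have := ltn_ord j; lia.
Qed.

Lemma coefM_low p q a b : (forall j, (j < a)%N -> p`_j = 0) ->
  (forall j, (j < b)%N -> q`_j = 0) -> (p * q)`_(a + b) = p`_a * q`_b.
Proof.
move=> pa qb; have ha : (a < (a + b).+1)%N by rewrite ltnS leq_addr.
rewrite coefM (bigD1 (Ordinal ha)) //= addKn big1 ?addr0 // => j ja.
have [/pa ->|aj] := ltnP j a; first by rewrite mul0r.
have aj' : (a < j)%N by rewrite ltn_neqAle aj andbT eq_sym; exact: ja.
rewrite qb ?mulr0 //; have := ltn_ord j; lia.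
Qed.

Lemma low_degM p q : p != 0 -> q != 0 ->
  low_deg (p * q) = (low_deg p + low_deg q)%N.
Proof.
move=> p0 q0; apply/eqP; rewrite eqn_leq; apply/andP; split.
  rewrite leqNgt; apply/negP => /coef_lt_low_deg/eqP; apply/negP.
  rewrite coefM_low; [|exact: coef_lt_low_deg..].
  by rewrite mulf_neq0 // coef_low_deg.
apply: leq_low_deg => [|i]; first by rewrite mulf_neq0.
exact/coefM_lt/coef_lt_low_deg/coef_lt_low_deg.
Qed.
End LowestDegree.

Section WeightedDegree.
Context (k : fieldType) (N : nat) (w : 'I_N -> nat).
Implicit Types (f g : {mpoly k[N]}) (u : 'X_{1..N}) (x y : ratfun k N).

Definition wdeg u : nat := (\sum_(i < N) w i * u i)%N.

End WeightedDegree.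

(* f |-> f(X_1 T^w_1, ..., X_N T^w_N), whose coefficient at T^n is the part of
   f of weight n. *)
HB.lock Definition grade (k : fieldType) (N : nat) (w : 'I_N -> nat) :
    {rmorphism {mpoly k[N]} -> {poly {mpoly k[N]}}} :=
  mmap (polyC \o @mpolyC N k) (fun i => ('X_i)%:P * 'X^(w i)).

Section GradeTheory.
Context (k : fieldType) (N : nat) (w : 'I_N -> nat).
Implicit Types (f g : {mpoly k[N]}) (u : 'X_{1..N}).
Local Notation wdeg := (wdeg w).
Local Notation grade := (@grade k N w).

Lemma gradeE f : grade f = \sum_(u <- msupp f) (f@_u *: 'X_[u]) *: 'X^(wdeg u).
Proof.
rewrite grade.unlock /= /mmap; apply: eq_bigr => u _.
rewrite /mmap1 (eq_bigr _ (fun i _ => exprMn (u i) _ _)) big_split /=.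
rewrite -mul_polyC -mul_mpolyC polyCM -mulrA; congr (_ * (_ * _)).
  by rewrite mpolyXE_id rmorph_prod; apply: eq_bigr => i _; rewrite rmorphXn.
by rewrite -prodrXr; apply: eq_bigr => i _; rewrite exprM.
Qed.

Lemma coef_grade f n u : (grade f)`_n@_u = (f@_u) *+ (wdeg u == n).
Proof.
rewrite gradeE coef_sum raddf_sum /=.
have E u' : (((f@_u' *: 'X_[u']) *: 'X^(wdeg u')) `_ n)@_u =
    if u' == u then (f@_u) *+ (wdeg u == n) else 0.
  rewrite coefZ coefXn; have [->|nu] := eqVneq u' u.
    rewrite eq_sym; case: eqP => _; last by rewrite mulr0 mcoeff0.
    by rewrite mulr1 mcoeffZ mcoeffX eqxx mulr1.
  case: (n == _); rewrite ?mulr0 ?mcoeff0 // mulr1 mcoeffZ mcoeffX (negPf nu).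
  by rewrite mulr0.
rewrite (eq_bigr _ (fun u' _ => E u')).
have [uf|uf] := boolP (u \in msupp f).
  by rewrite (bigD1_seq u) //= eqxx big1 ?addr0 // => i /negPf->.
rewrite big1_seq ?(memN_msupp_eq0 uf) ?mul0rn // => u' /= u'f.
by case: eqP => // e; rewrite -e u'f in uf.
Qed.

Lemma grade_inj : injective grade.
Proof.
move=> f g fg; apply/mpolyP => u.
by have := coef_grade f (wdeg u) u; rewrite fg coef_grade eqxx !mulr1n.
Qed.

Lemma grade_eq0 f : (grade f == 0) = (f == 0).
Proof. by rewrite -(inj_eq grade_inj) rmorph0. Qed.

End GradeTheory.

HB.lock Definition mord (k : fieldType) (N : nat) (w : 'I_N -> nat)
  (f : {mpoly k[N]}) : nat := low_deg (@grade k N w f).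

Section OrderTheory.
Context (k : fieldType) (N : nat) (w : 'I_N -> nat).
Implicit Types (f g : {mpoly k[N]}) (u : 'X_{1..N}) (x y : ratfun k N).
Local Notation wdeg := (wdeg w).
Local Notation grade := (@grade k N w).
Local Notation mord := (mord w).

Lemma mordE f : mord f = low_deg (grade f).
Proof. by rewrite mord.unlock. Qed.

(** [grade] is an injective ring morphism into polynomials over a domain, where lowest coefficients
    multiply to a nonzero element. *)
Lemma mordM f g : f != 0 -> g != 0 -> mord (f * g) = (mord f + mord g)%N.
Proof. by move=> f0 g0; rewrite !mordE rmorphM low_degM ?grade_eq0. Qed.

Lemma coef_grade_lt f n : (forall u, u \in msupp f -> (n <= wdeg u)%N) ->
  forall i, (i < n)%N -> (grade f)`_i = 0.
Proof.
move=> fn i ni; apply/mpolyP => u; rewrite coef_grade mcoeff0.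
case: (eqVneq (wdeg u) i) => [ui|]; last by rewrite mulr0n.
rewrite (memN_msupp_eq0 (_ : u \notin msupp f)) ?mul0rn //.
by apply/negP => /fn; rewrite ui leqNgt ni.
Qed.

Lemma leq_mord f n : f != 0 -> (forall u, u \in msupp f -> (n <= wdeg u)%N) ->
  (n <= mord f)%N.
Proof.
move=> f0 fn; rewrite mordE; apply: leq_low_deg; first by rewrite grade_eq0.
exact: coef_grade_lt.
Qed.

Lemma mord_leq f u : u \in msupp f -> (mord f <= wdeg u)%N.
Proof.
rewrite leqNgt mcoeff_msupp mordE => uf; apply/negP => /coef_lt_low_deg fu.
by move: uf (coef_grade w f (wdeg u) u); rewrite fu mcoeff0 eqxx => /eqP + /esym.
Qed.

Lemma mord_attained f : f != 0 -> exists2 u, u \in msupp f & wdeg u = mord f.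
Proof.
move=> f0; have f0' : grade f != 0 by rewrite grade_eq0.
have := coef_low_deg f0'; rewrite -mordE -msupp_eq0.
case E : (msupp _) => [//|u s] _; have : u \in msupp (grade f)`_(mord f).
  by rewrite E inE eqxx.
rewrite mcoeff_msupp coef_grade; case: (eqVneq (wdeg u) (mord f)) => [<-|];
  last by rewrite mulr0n eqxx.
by rewrite mulr1n => uf; exists u => //; rewrite mcoeff_msupp.
Qed.

Lemma mordC (c : k) : mord c%:MP = 0%N.
Proof.
have [->|c0] := eqVneq c 0.
  by rewrite mpolyC0 mordE rmorph0 /low_deg polyseq0.
apply/eqP; rewrite -leqn0; suff <- : wdeg 0%MM = 0%N.
  by apply: mord_leq; rewrite msuppC (negPf c0) inE.
by rewrite /wdeg big1 // => i _; rewrite mnm0E muln0.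
Qed.

Lemma wdegU i : wdeg U_(i)%MM = w i.
Proof.
rewrite /wdeg (bigD1 i) //= mnm1E eqxx muln1 big1 ?addn0 // => j ji.
by rewrite mnm1E eq_sym (negPf ji) muln0.
Qed.

Lemma mordX u : mord ('X_[u] : {mpoly k[N]}) = wdeg u.
Proof.
have X0 : 'X_[k, u] != 0 by rewrite -msupp_eq0 msuppX.
by have [v] := mord_attained X0; rewrite msuppX inE => /eqP->.
Qed.

End OrderTheory.

HB.lock Definition wval (k : fieldType) (N : nat) (w : 'I_N -> nat)
  (x : ratfun k N) : int :=
  (mord w \n_(repr x))%:Z - (mord w \d_(repr x))%:Z.

Section ValuationTheory.
Context (k : fieldType) (N : nat) (w : 'I_N -> nat).
Implicit Types (f g : {mpoly k[N]}) (u : 'X_{1..N}) (x y : ratfun k N).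
Local Notation wdeg := (wdeg w).
Local Notation mord := (mord w).
Local Notation wval := (wval w).

Lemma ratfunE x : x = (\n_(repr x))%:F / (\d_(repr x))%:F.
Proof.
set n := (frac (repr x)).1; set d := (frac (repr x)).2.
have d0 : d != 0 by exact: denom_ratioP.
apply: (mulIf (_ : d%:F != 0)); rewrite ?divfK ?tofrac_eq0 //.
rewrite -[x in LHS]reprK /n /d.
case: (repr x) => -[n' d'] /= h; unlock FracField.tofrac.
rewrite -[LHS]FracField.pi_mul; apply/eqmodP.
rewrite /= FracField.equivfE /FracField.mulf /= !numden_Ratio ?oner_neq0
  ?mulr1 //=.
by rewrite mulrC.
Qed.

Lemma ratfunP x : exists f g, g != 0 /\ x = f%:F / g%:F.
Proof.
exists \n_(repr x), \d_(repr x); split; first exact: denom_ratioP.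
exact: ratfunE.
Qed.

Lemma frac_eq0 f g : g != 0 -> (f%:F / g%:F == 0 :> ratfun k N) = (f == 0).
Proof. by move=> g0; rewrite mulf_eq0 invr_eq0 !tofrac_eq0 (negPf g0) orbF. Qed.

Lemma wval_frac f g : f != 0 -> g != 0 ->
  wval (f%:F / g%:F) = (mord f)%:Z - (mord g)%:Z.
Proof.
move=> f0 g0; rewrite wval.unlock; set x := _ / _.
set n := \n_(repr x); set d := \d_(repr x).
have d0 : d != 0 by exact: denom_ratioP.
have xE : x = n%:F / d%:F by exact: ratfunE.
have n0 : n != 0.
  have : x != 0 by rewrite mulf_neq0 ?invr_eq0 ?tofrac_eq0.
  by apply: contraNneq => n0; rewrite xE n0 tofrac0 mul0r.
have : f * d = n * g.
  apply/eqP; rewrite -tofrac_eq !tofracM -GRing.eqr_div ?tofrac_eq0 //.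
  by rewrite -xE.
move/(congr1 mord); rewrite (mordM w f0 d0) (mordM w n0 g0).
by move: (mord f) (mord g) (mord n) (mord d) => *; lia.
Qed.

Lemma wvalF f : f != 0 -> wval f%:F = (mord f)%:Z.
Proof.
move=> f0; rewrite -[f%:F]divr1 -tofrac1 wval_frac ?oner_neq0 //.
by rewrite -[1]/(1%:MP) mordC subr0.
Qed.

Lemma wvalC (c : k) : c != 0 -> wval (c%:MP)%:F = 0.
Proof. by move=> c0; rewrite wvalF ?mpolyC_eq0 // mordC. Qed.

Lemma wvalM x y : x != 0 -> y != 0 -> wval (x * y) = wval x + wval y.
Proof.
have [a [b [b0 ->]]] := ratfunP x; have [c [d [d0 ->]]] := ratfunP y.
rewrite frac_eq0 // => a0; rewrite frac_eq0 // => c0.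
rewrite mulf_div -!tofracM [LHS]wval_frac; [|exact: mulf_neq0..].
rewrite !wval_frac //.
by rewrite !mordM //; lia.
Qed.

Lemma wval1 : wval (1 : ratfun k N) = 0.
Proof. by rewrite -(wvalC (oner_neq0 k)) mpolyC1 tofrac1. Qed.

Lemma wvalV x : x != 0 -> wval x^-1 = - wval x.
Proof.
move=> x0; apply/eqP; rewrite -addr_eq0 -wvalM ?invr_eq0 //.
by rewrite mulVf // wval1.
Qed.

Lemma wvalXn x n : x != 0 -> wval (x ^+ n) = wval x *+ n.
Proof.
move=> x0; elim: n => [|n IH]; first by rewrite expr0 wval1.
by rewrite exprS mulrS wvalM ?expf_neq0 // IH.
Qed.

Lemma wvalXz x (n : int) : x != 0 -> wval (x ^ n) = wval x * n.
Proof.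
move=> x0; case: n => n; first by rewrite -exprnP wvalXn // -mulr_natr natz.
by rewrite NegzE -exprz_inv -exprnP wvalXn ?invr_eq0 // wvalV //
  -mulr_natr natz mulrN mulNr.
Qed.

Lemma wval_prod (I : Type) (r : seq I) (F : I -> ratfun k N) :
  (forall i, F i != 0) ->
  \prod_(i <- r) F i != 0 /\ wval (\prod_(i <- r) F i) = \sum_(i <- r) wval (F i).
Proof.
move=> F0; elim: r => [|i r [IH0 IH]]; first by rewrite !big_nil oner_neq0 wval1.
rewrite !big_cons; split; first by rewrite mulf_eq0 (negPf (F0 i)) (negPf IH0).
by rewrite (wvalM (F0 i) IH0) IH.
Qed.

(** The value of [wval] at 0 is meaningless; this predicate treats 0 as having value +oo. *)
Definition vge (n : int) x : bool := (x == 0) || (n <= wval x).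

Lemma vge0 n : vge n (0 : ratfun k N). Proof. by rewrite /vge eqxx. Qed.

Lemma vge_frac n f g : g != 0 ->
  vge n (f%:F / g%:F) = (f == 0) || (n + (mord g)%:Z <= (mord f)%:Z).
Proof.
move=> g0; rewrite /vge frac_eq0 //.
by case: eqVneq => //= f0; rewrite wval_frac // lerBrDr.
Qed.

Lemma vgeM m n x y : vge m x -> vge n y -> vge (m + n) (x * y).
Proof.
rewrite /vge; have [->|x0] := eqVneq x 0; first by rewrite mul0r eqxx.
have [->|y0] := eqVneq y 0; first by rewrite mulr0 eqxx.
rewrite mulf_eq0 (negPf x0) (negPf y0) !orFb.
move=> mx ny.
by rewrite (wvalM x0 y0) lerD.
Qed.

Lemma vgeW m n x : m <= n -> vge n x -> vge m x.
Proof. by move=> mn /orP[x0|nx]; apply/orP; [left|right; exact: le_trans nx]. Qed.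

(** Over a common denominator, every monomial of the sum of numerators occurs in one of the two
    summands. *)
Lemma vgeD n x y : vge n x -> vge n y -> vge n (x + y).
Proof.
have [a [b [b0 ->]]] := ratfunP x; have [c [d [d0 ->]]] := ratfunP y.
rewrite addf_div ?tofrac_eq0 // -!tofracM -tofracD !vge_frac ?mulf_neq0 //.
have [->|a0] := eqVneq a 0.
  rewrite mul0r add0r mulf_eq0 (negPf b0) orbF => _.
  by case: eqVneq => //= c0 nc; rewrite !mordM //; lia.
have [->|c0] := eqVneq c 0.
  rewrite mul0r addr0 mulf_eq0 (negPf a0) (negPf d0) /= => na _.
  by rewrite !mordM //; lia.
rewrite /= => na nc; case: eqVneq => //= s0.
have : (minn (mord (a * d)) (mord (c * b)) <= mord (a * d + c * b))%N.
  apply: leq_mord => // u /msuppD_le; rewrite mem_cat geq_min.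
  by case/orP => /mord_leq ->; rewrite ?orbT.
rewrite !mordM //; move: (mord (_ + _)) na nc.
move: (mord a) (mord b) (mord c) (mord d) => A B C D M na nc; rewrite geq_min.
by case/orP => AM; [move: na|move: nc]; lia.
Qed.

Lemma vge_sum n (I : Type) (r : seq I) (P : pred I) (F : I -> ratfun k N) :
  (forall i, P i -> vge n (F i)) -> vge n (\sum_(i <- r | P i) F i).
Proof.
move=> nF; apply: (big_ind (fun x => vge n x)) => //; first exact: vge0.
exact: vgeD.
Qed.

Lemma vge0_prod (I : Type) (r : seq I) (P : pred I) (F : I -> ratfun k N) :
  (forall i, P i -> vge 0 (F i)) -> vge 0 (\prod_(i <- r | P i) F i).
Proof.
move=> nF; apply: (big_ind (fun x => vge 0 x)) => //.
  by rewrite /vge wval1 lexx orbT.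
by move=> x y; rewrite -[X in _ -> _ -> vge X _]addr0; exact: vgeM.
Qed.

Lemma vge_poly f : vge 0 f%:F.
Proof.
rewrite /vge tofrac_eq0; case: eqVneq => //= f0.
by rewrite wvalF.
Qed.

Lemma vge_int (n : int) : vge 0 (n%:~R : ratfun k N).
Proof. by rewrite -(rmorph_int (@FracField.tofrac _)); exact: vge_poly. Qed.

Lemma vgeN n x : vge n x -> vge n (- x).
Proof.
move=> nx; rewrite -mulN1r -[n]add0r; apply: vgeM => //.
exact: (vge_int (-1)).
Qed.

Lemma wval_int (n : int) : n%:~R != 0 :> ratfun k N -> wval (n%:~R : ratfun k N) = 0.
Proof.
rewrite -(rmorph_int (@FracField.tofrac _)) tofrac_eq0.
by rewrite -(rmorph_int (@mpolyC N k)) mpolyC_eq0; exact: wvalC.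
Qed.

Lemma vge_det (n : nat) (A : 'M[ratfun k N]_n) :
  (forall i j, vge 0 (A i j)) -> vge 0 (\det A).
Proof.
move=> A0; apply: vge_sum => s _; rewrite -[X in vge X _]addr0; apply: vgeM.
  by case: (odd_perm s); rewrite ?expr0; [exact: (vge_int (-1))|exact: (vge_int 1)].
exact: vge0_prod.
Qed.

End ValuationTheory.

(** * The divisor of a primitive weight *)

Fact mul_divA4 (K : fieldType) (a b c d : K) : b != 0 ->
  a * b * (c * (d / b)) = c * d * a.
Proof. by move=> b0; field. Qed.

Fact mulrACA4 (R : comRingType) (a b c d e : R) :
  a * b * c * (d * e) = b * c * e * (a * d).
Proof. by ring. Qed.

(** Reducing X^m modulo [Q] writes (f/g)^m as a combination of powers below [size Q], so
    [g ^+ size Q] is a denominator common to all m. *)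
Lemma integral_cic (D : idomainType) (Q : {poly D}) (f g : D) :
  completely_integrally_closed D -> g != 0 -> Q \is monic ->
  root (map_poly (@FracField.tofrac D) Q) (f%:F / g%:F) -> exists q, f = q * g.
Proof.
move=> DC g0 Qm /rootP Qy; apply: (DC f g (g ^+ size Q)) => // [|m].
  exact: expf_neq0.
pose r := Pdiv.Ring.rmodp 'X^m Q.
have sr : (size r <= size Q)%N.
  by rewrite ltnW // Pdiv.Ring.ltn_rmodp monic_neq0.
have ym : (f%:F / g%:F) ^+ m = (map_poly (@FracField.tofrac D) r).[f%:F / g%:F].
  have := congr1 (fun p => (map_poly (@FracField.tofrac D) p).[f%:F / g%:F])
    (Pdiv.RingMonic.rdivp_eq Qm 'X^m).
  by rewrite /= map_polyXn hornerXn rmorphD rmorphM /= hornerD hornerM Qy mulr0 add0r.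
exists (\sum_(i < size r) r`_i * f ^+ i * g ^+ (size Q - i)).
have gF0 : g%:F != 0 by rewrite tofrac_eq0.
apply/eqP; rewrite -tofrac_eq !tofracM !tofracXn; apply/eqP.
rewrite -[f%:F in LHS](divfK gF0) exprMn ym mulrA; congr (_ * _).
rewrite horner_coef size_map_inj_poly ?rmorph0 //; last first.
  by move=> a b /eqP; rewrite tofrac_eq => /eqP.
rewrite rmorph_sum /= mulr_sumr; apply: eq_bigr => i _.
have iQ : (i <= size Q)%N by rewrite (leq_trans (ltnW (ltn_ord i))).
rewrite coef_map /= !tofracM !tofracXn -[in LHS](subnK iQ) exprD exprMn.
rewrite exprVn; exact/mul_divA4/expf_neq0.
Qed.

Section Chart.
Context (k : fieldType) (N : nat) (w : 'I_N -> nat).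
Implicit Types (f g : {mpoly k[N]}) (u : 'I_N -> int) (x y : ratfun k N).

Local Notation Xf i := (('X_i : {mpoly k[N]})%:F).

Definition lmon u : ratfun k N := \prod_(i < N) Xf i ^ u i.

Lemma XF_neq0 (i : 'I_N) : Xf i != 0.
Proof. by rewrite tofrac_eq0 -msupp_eq0 msuppX. Qed.

Definition iweight u : int := \sum_(i < N) u i * (w i)%:Z.

Lemma lmon_neq0 u : lmon u != 0.
Proof. by apply/prodf_neq0 => i _; rewrite expfz_neq0 // XF_neq0. Qed.

Lemma wval_lmon u : wval w (lmon u) = iweight u.
Proof.
have [i|_ ->] := wval_prod w (index_enum 'I_N) (F := fun i => Xf i ^ u i).
  by rewrite expfz_neq0 // XF_neq0.
apply: eq_bigr => i _.
by rewrite wvalXz ?XF_neq0 // wvalF ?mordX ?wdegU 1?mulrC // -msupp_eq0 msuppX.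
Qed.

Lemma lmonD u u' : lmon (fun i => u i + u' i) = lmon u * lmon u'.
Proof.
by rewrite /lmon -big_split /=; apply: eq_bigr => i _; rewrite expfzDr // XF_neq0.
Qed.

Lemma lmonMz u (c : int) : lmon (fun i => c * u i) = lmon u ^ c.
Proof.
rewrite /lmon; have -> : \prod_i Xf i ^ (c * u i) = \prod_i (Xf i ^ u i) ^ c.
  by apply: eq_bigr => i _; rewrite mulrC exprz_exp.
by elim/big_rec2: _ => [|i a b _ ->]; rewrite ?exp1rz // expfzMl.
Qed.

Lemma lmon_sum (I : Type) (r : seq I) (F : I -> 'I_N -> int) :
  lmon (fun l => \sum_(i <- r) F i l) = \prod_(i <- r) lmon (F i).
Proof.
elim: r => [|i r IH].
  by rewrite big_nil /lmon big1 // => i _; rewrite big_nil expr0z.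
rewrite big_cons -IH -lmonD; congr lmon; apply/funext => l.
by rewrite big_cons.
Qed.

Lemma iweightB u u' : iweight (fun i => u i - u' i) = iweight u - iweight u'.
Proof. by rewrite /iweight -sumrB; apply: eq_bigr => i _; rewrite mulrBl. Qed.

Lemma iweight_mnm (m : 'X_{1..N}) : iweight (fun i => (m i)%:Z) = (wdeg w m)%:Z.
Proof.
rewrite /wdeg /iweight; elim/big_rec2: _ => // i a b _ ->.
by rewrite PoszD mulrC.
Qed.

Lemma lmonN u : lmon (fun i => - u i) = (lmon u)^-1.
Proof.
rewrite -[RHS]/(lmon u ^ (- 1)) -lmonMz; congr lmon; apply/funext => i.
by rewrite mulN1r.
Qed.

Lemma lmon_mnm (m : 'X_{1..N}) : lmon (fun i => (m i)%:Z) = ('X_[m])%:F.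
Proof.
by rewrite mpolyXE_id rmorph_prod; apply: eq_bigr => i _; rewrite rmorphXn.
Qed.

Definition allX : {mpoly k[N]} := 'X_[[multinom 1%N | i < N]].

Lemma allX_neq0 : allX%:F != 0.
Proof. by rewrite tofrac_eq0 -msupp_eq0 msuppX. Qed.

Lemma allXn e : allX%:F ^+ e = lmon (fun=> e%:Z).
Proof.
rewrite /allX -lmon_mnm -[_ ^+ e]/(_ ^ e%:Z) -lmonMz; congr lmon.
by apply/funext => i; rewrite mnmE mulr1.
Qed.

Definition laurent : set (ratfun k N) :=
  [set x | exists e f, x * allX%:F ^+ e = f%:F].

Lemma laurentW x e f e' : x * allX%:F ^+ e = f%:F -> (e <= e')%N ->
  x * allX%:F ^+ e' = (f * allX ^+ (e' - e))%:F.
Proof.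
by move=> xe ee'; rewrite -(subnKC ee') exprD mulrA xe addKn tofracM tofracXn.
Qed.

Lemma laurentD x y : laurent x -> laurent y -> laurent (x + y).
Proof.
move=> [e [f xe]] [e' [f' ye]].
exists (maxn e e'); rewrite mulrDl (laurentW xe) ?leq_maxl //.
by rewrite (laurentW ye) ?leq_maxr // -tofracD; eexists.
Qed.

Lemma laurentM x y : laurent x -> laurent y -> laurent (x * y).
Proof.
move=> [e [f xe]] [e' [f' ye]]; exists (e + e')%N, (f * f').
by rewrite exprD mulrACA xe ye tofracM.
Qed.

Lemma laurentF f : laurent f%:F.
Proof. by exists 0%N, f; rewrite mulr1. Qed.

Lemma laurent1 : laurent 1.
Proof. by rewrite -(tofrac1 {mpoly k[N]}); exact: laurentF. Qed.

Lemma laurent_lmon u : laurent (lmon u).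
Proof.
apply: (big_ind laurent); [exact: laurent1|exact: laurentM|].
have lX x : laurent x -> forall n, laurent (x ^+ n).
  move=> lx; elim=> [|n IH]; first exact: laurent1.
  by rewrite exprS; exact: laurentM.
move=> i _; case: (u i) => n; first by apply: lX; exact: laurentF.
rewrite NegzE -exprz_inv; apply: lX.
exists 1%N, 'X_[[multinom 1%N | i < N] - U_(i)].
rewrite expr1 /allX -[in LHS](@submK _ U_(i)%MM [multinom 1%N | i < N]); last first.
  by rewrite lep1mP mnmE.
by rewrite mpolyXD tofracM mulrCA mulVf ?mulr1 // XF_neq0.
Qed.

(** As an intersection, its integral closedness splits into one statement per factor; the
    description by monomials is recovered in [wchart_fg]. *)
Definition wchart : set (ratfun k N) := [set x | vge w 0 x /\ laurent x].

Lemma wchartD x y : wchart x -> wchart y -> wchart (x + y).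
Proof. by move=> [x0 xl] [y0 yl]; split; [exact: vgeD|exact: laurentD]. Qed.

Lemma wchartM x y : wchart x -> wchart y -> wchart (x * y).
Proof.
by move=> [x0 xl] [y0 yl]; split; [exact: (vgeM x0 y0)|exact: laurentM].
Qed.

Lemma wchartF f : wchart f%:F.
Proof. by split; [exact: vge_poly|exact: laurentF]. Qed.

Lemma wchart_lmon u : 0 <= iweight u -> wchart (lmon u).
Proof.
by move=> u0; split; [rewrite /vge wval_lmon u0 orbT|exact: laurent_lmon].
Qed.

(** If x had negative value, the equation would give x^n the value at least (n - 1) times that of x,
    which is larger than n times it. *)
Lemma vge_integral x (p : {poly ratfun k N}) : p \is monic ->
  (forall i, vge w 0 p`_i) -> root p x -> vge w 0 x.
Proof.
move=> pm p0 /rootP px; rewrite /vge; have [//|x0] := eqVneq x 0 => /=.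
rewrite leNgt; apply/negP => wx.
have sp : size p = (size p).-1.+1 by rewrite prednK // lt0n size_poly_eq0 monic_neq0.
move: px; rewrite horner_coef sp big_ord_recr /= -/(lead_coef p) (monicP pm) mul1r.
set n := (size p).-1 => /eqP; rewrite addrC addr_eq0 => /eqP xn.
have : vge w (wval w x * (n.-1)%:Z) (x ^+ n).
  rewrite xn; apply/vgeN/vge_sum => i _; rewrite -[X in vge _ X]add0r.
  apply: vgeM => //; rewrite /vge expf_eq0 (negPf x0) andbF /=.
  rewrite wvalXn // -mulr_natr natz ler_wnM2l ?(ltW wx) // lez_nat.
  by rewrite -ltnS (leq_trans (ltn_ord i)) // leqSpred.
have n0 : (0 < n)%N.
  rewrite lt0n; apply/eqP => n0; move: xn; rewrite n0 big_ord0 oppr0 => /eqP.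
  by rewrite oner_eq0.
rewrite /vge expf_eq0 (negPf x0) andbF /= wvalXn // -mulr_natr natz.
by rewrite ler_nM2l // lez_nat leqNgt prednK // leqnn.
Qed.

(** Multiplying x by a power of [allX] that clears the denominators of all coefficients of [p] makes
    it integral over k[X], hence a polynomial. *)
Lemma laurent_integral x (p : {poly ratfun k N}) : p \is monic ->
  (forall i, laurent p`_i) -> root p x -> laurent x.
Proof.
move=> pm pl /rootP px.
have [e pe] : exists e : nat, forall i, exists f, p`_i * allX%:F ^+ e = f%:F.
  have [e eP] := choice pl; exists (\max_(i < size p) e i)%N => i.
  have [ip|pi] := ltnP i (size p).
    have [f fE] := eP i; have ei : (e i <= \max_(i < size p) e i)%N.
      by rewrite (bigD1 (Ordinal ip)) //= leq_maxl.
    by rewrite (laurentW fE ei); eexists.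
  by exists 0; rewrite nth_default // mul0r tofrac0.
have [F FE] := choice pe.
pose n := (size p).-1.
have sp : size p = n.+1 by rewrite prednK // lt0n size_poly_eq0 monic_neq0.
(* The equation of x allX^e has coefficients p_i allX^(e(n-i)). One factor allX^e is spent on
   turning p_i into [F i], which explains the predecessor in the exponent. *)
pose Q := 'X^n + \poly_(i < n) (F i * allX ^+ (e * (n - i).-1)).
have Qm : Q \is monic.
  rewrite monicE /Q lead_coefDl ?lead_coefXn // size_polyXn.
  by rewrite ltnS size_poly.
have [f [g [g0 yE]]] := ratfunP (x * allX%:F ^+ e).
have [|q fE] := integral_cic (@cic_mpoly k N) g0 Qm (f := f).
  apply/rootP; rewrite -yE /Q rmorphD /= map_polyXn hornerD hornerXn.
  rewrite poly_def raddf_sum horner_sum /=.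
  transitivity (allX%:F ^+ (e * n) * p.[x]); last by rewrite px mulr0.
  rewrite horner_coef sp big_ord_recr /= -/(lead_coef p) (monicP pm) mul1r.
  rewrite mulrDr addrC exprMn -exprM [x ^+ n * _]mulrC mulr_sumr; congr (_ + _).
  apply: eq_bigr => i _; rewrite map_polyZ map_polyXn hornerZ hornerXn.
  rewrite /= tofracM tofracXn -FE exprMn -exprM.
  have -> : (e * n = e + e * (n - i).-1 + e * i)%N.
    by rewrite -mulnS prednK ?subn_gt0 // -mulnDr subnK // ltnW.
  by rewrite !exprD; exact: mulrACA4.
exists e, q; rewrite yE fE tofracM mulfK // tofrac_eq0.
exact: g0.
Qed.

Lemma wchart_integrally_closed : integrally_closed wchart.
Proof.
move=> x [p [pm pB px]]; split.
  by apply: (vge_integral pm _ px) => i; case: (pB i).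
by apply: (laurent_integral pm _ px) => i; case: (pB i).
Qed.

(** * Generators of the chart and its prime divisor *)

Section Generation.
Context (v : 'I_N -> int) (wv : iweight v = 1).

Definition koszul (i j : 'I_N) : 'I_N -> int :=
  fun l => (w j)%:Z * (l == i)%:Z - (w i)%:Z * (l == j)%:Z.

Definition wgen (t : option ('I_N * 'I_N)) : ratfun k N :=
  lmon (if t is Some (i, j) then koszul i j else v).

Let gen := generated_by (fun i : 'I_#|{: option ('I_N * 'I_N)}| => wgen (enum_val i)).

Lemma iweight_koszul i j : iweight (koszul i j) = 0.
Proof.
rewrite /iweight /koszul.
under eq_bigr do rewrite mulrBl.
rewrite sumrB (bigD1 i) //= big1 ?addr0 => [|l /negPf ->]; last by rewrite mulr0 mul0r.
rewrite (bigD1 j) //= big1 ?addr0 => [|l /negPf ->]; last by rewrite mulr0 mul0r.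
by rewrite !eqxx !mulr1 mulrC subrr.
Qed.

Lemma genC (c : k) : gen (c%:MP)%:F.
Proof.
exists c%:MP => //.
exact: (mmapC _ (@FracField.tofrac _ \o @mpolyC N k)).
Qed.

Lemma gen_wgen t : gen (wgen t).
Proof.
exists 'X_(enum_rank t) => //.
rewrite (mmapX _ (@FracField.tofrac _ \o @mpolyC N k)) mmap1U.
by rewrite enum_rankK.
Qed.

Lemma genD x y : gen x -> gen y -> gen (x + y).
Proof.
move=> [p _ <-] [q _ <-]; exists (p + q) => //.
exact: (rmorphD (mmap (@FracField.tofrac _ \o @mpolyC N k) _)).
Qed.

Lemma gen1 : gen 1.
Proof. by rewrite -(tofrac1 {mpoly k[N]}) -(mpolyC1 N k); exact: genC. Qed.

Lemma genXn x n : gen x -> gen (x ^+ n).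
Proof.
by move=> gx; elim: n => [|n IH]; [exact: gen1|rewrite exprS; exact: generated_byM].
Qed.

Lemma gen_koszul i j (c : int) : gen (lmon (koszul i j) ^ c).
Proof.
case: c => n; first exact/genXn/(gen_wgen (Some (i, j))).
rewrite NegzE -exprz_inv -lmonN.
suff -> : (fun l => - koszul i j l) = koszul j i by exact/genXn/(gen_wgen (Some (j, i))).
by apply/funext => l; rewrite /koszul opprB.
Qed.

(* Koszul relations generate the syzygies of a unimodular row. *)
Lemma koszul_decomp u : u = fun l => iweight u * v l +
  \sum_(ij <- index_enum ('I_N * 'I_N)%type) v ij.2 * u ij.1 * koszul ij.1 ij.2 l.
Proof.
apply/funext => l.
rewrite -(pair_bigA _ (fun i j => v j * u i * koszul i j l)) /=.
have E i : \sum_j v j * u i * koszul i j l =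
    u i * (l == i)%:Z - u i * (w i)%:Z * v l.
  under eq_bigr do rewrite /koszul mulrBr.
  rewrite sumrB; congr (_ - _).
    rewrite -[RHS]mul1r -wv /iweight mulr_suml; apply: eq_bigr => j _.
    by ring.
  rewrite (bigD1 l) //= eqxx mulr1 big1 ?addr0; first by ring.
  by move=> j; rewrite eq_sym => /negPf ->; rewrite !mulr0.
under eq_bigr do rewrite E.
rewrite sumrB -mulr_suml -/(iweight u) addrC subrK (bigD1 l) //= eqxx mulr1.
by rewrite big1 ?addr0 // => i; rewrite eq_sym => /negPf ->; rewrite mulr0.
Qed.

(** In the decomposition of [u] the Koszul vectors may carry negative coefficients, since swapping
    the indices inverts the monomial; [v] occurs with coefficient [iweight u], which is
    nonnegative. *)
Lemma gen_lmon u : 0 <= iweight u -> gen (lmon u).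
Proof.
move=> u0; rewrite (koszul_decomp u) lmonD lmonMz lmon_sum; apply: generated_byM.
  by case: (iweight u) u0 => // n _; exact/genXn/(gen_wgen None).
apply: (big_ind gen); [exact: gen1|exact: generated_byM|].
by move=> ij _; rewrite lmonMz; exact: gen_koszul.
Qed.

(** The value of a Laurent polynomial is the least weight of its monomials, so an element of the
    chart is a sum of monomials of nonnegative weight. *)
Lemma wchart_fg : wchart = gen.
Proof.
apply/seteqP; split => [x [x0 [e [f xf]]]|_ [p _ <-]]; last first.
  apply: (big_ind wchart); [|exact: wchartD|].
    by rewrite -(tofrac0 {mpoly k[N]}); exact: wchartF.
  move=> m _; apply: wchartM; first exact: wchartF.
  have w1 : wchart 1 by rewrite -(tofrac1 {mpoly k[N]}); exact: wchartF.
  apply: (big_ind wchart); [by []|exact: wchartM|].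
  move=> i _; elim: (m i) => [|n IH] //; rewrite exprS; apply: wchartM => //.
  apply: wchart_lmon; case: (enum_val i) => [[i' j']|]; last by rewrite wv.
  by rewrite iweight_koszul.
have -> : x = \sum_(u <- msupp f) (f@_u)%:MP%:F * lmon (fun i => (u i)%:Z - e%:Z).
  apply: (mulIf (expf_neq0 e allX_neq0)); rewrite xf mulr_suml [in LHS](mpolyE f).
  rewrite rmorph_sum; apply: eq_bigr => u _.
  rewrite -mulrA allXn -lmonD -mul_mpolyC /= tofracM -lmon_mnm; congr (_ * lmon _).
  by apply/funext => i; rewrite subrK.
rewrite big_seq; apply: (big_ind gen); [|exact: genD|].
  by rewrite -(tofrac0 {mpoly k[N]}) -(mpolyC0 N k); exact: genC.
move=> u uf; apply: generated_byM; first exact: genC.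
apply: gen_lmon.
have f0 : f != 0 by apply: contraTneq uf => ->; rewrite msupp0.
have x0' : x != 0.
  apply: contraNneq f0 => xz; move/eqP: xf; rewrite xz mul0r eq_sym tofrac_eq0.
  by [].
move: x0; rewrite /vge (negPf x0') /= => x0.
have := congr1 (wval w) xf.
rewrite (wvalM w x0' (expf_neq0 e allX_neq0)) allXn wval_lmon (wvalF w f0).
have := mord_leq w uf; rewrite iweightB iweight_mnm.
by move: x0; lia.
Qed.

Local Notation t := (lmon v).

Lemma wval_t : wval w t = 1. Proof. by rewrite wval_lmon. Qed.

Lemma wval_tz n : wval w (t ^ n) = n.
Proof. by rewrite (wvalXz w n (lmon_neq0 v)) wval_t mul1r. Qed.

Lemma tz_neq0 (n : int) : t ^ n != 0.
Proof. by rewrite expfz_neq0 // lmon_neq0. Qed.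

Lemma laurent_tz (n : int) : laurent (t ^ n).
Proof. by rewrite -lmonMz; exact: laurent_lmon. Qed.

Lemma vge_tz (n : int) : vge w n (t ^ n).
Proof. by rewrite /vge wval_tz lexx orbT. Qed.

Lemma wchart_tz n x : vge w n x -> laurent x -> wchart (x * t ^ (- n)).
Proof.
move=> xn xl; split; last exact/laurentM/laurent_tz.
by rewrite -(subrr n); exact/vgeM/vge_tz.
Qed.

Definition wprime : set (ratfun k N) := [set x | wchart x /\ vge w 1 x].

Lemma wprime_t : wprime t.
Proof.
split; first by apply: wchart_lmon; rewrite wv.
by have := vge_tz 1; rewrite expr1z.
Qed.

Lemma wprimeP : is_prime wchart wprime.
Proof.
split; first split.
- by move=> x [].
- by split; [rewrite -(tofrac0 {mpoly k[N]}); exact: wchartF|exact: vge0].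
- by move=> x y [xB x1] [yB y1]; split; [exact: wchartD|exact: vgeD].
- move=> b x bB [xB x1]; split; first exact: wchartM.
  by rewrite -[X in vge _ X]add0r; apply: vgeM => //; case: bB.
- by move=> [_]; rewrite /vge wval1 oner_eq0.
- move=> x y xB yB [_ xy].
  have [x1|/negP x1] := boolP (vge w 1 x); first by left.
  have [y1|/negP y1] := boolP (vge w 1 y); first by right.
  have x0 : x != 0 by apply/negP => /eqP x0; apply: x1; rewrite x0 vge0.
  have y0 : y != 0 by apply/negP => /eqP y0; apply: y1; rewrite y0 vge0.
  exfalso; move: xB.1 yB.1 x1 y1 xy; rewrite /vge mulf_eq0 (negPf x0) (negPf y0).
  rewrite (wvalM w x0 y0) /=; move: (wval w x) (wval w y) => a b.
  by lia.
Qed.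

(** Let q be a nonzero element of a prime Q inside the prime of E. Then q = q' t^n with q' of value
    0, so q' is not in Q and t is. As every element of value at least 1 is t times an element of the
    chart, Q is the whole prime. *)
Lemma wprime_height_one : height_one wchart wprime.
Proof.
split; first exact: wprimeP.
  by move=> P0; have := wprime_t; rewrite P0 => /eqP; rewrite (negPf (lmon_neq0 v)).
move=> Q Qp QP; have [[QB Q0 QD QM] Q1 Qx] := Qp.
have [[q Qq q0]|nQ] := pselect (exists2 q, Q q & q != 0); last first.
  left; apply/seteqP; split => [x Qxx|_ -> //]; apply: contrapT => x0.
  by apply: nQ; exists x => //; apply/eqP.
right; apply/seteqP; split => // x [[x0 xl] x1].
have tB : wchart t by case: wprime_t.
suff Qt : Q t.
  rewrite -(divfK (lmon_neq0 v) x); apply: QM => //.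
  exact: (wchart_tz x1 xl).
have [[qv ql] qv1] := QP _ Qq.
have : Q (q * t ^ (- wval w q) * t ^ (wval w q)).
  by rewrite -mulrA -expfzDr ?lmon_neq0 // addNr expr0z mulr1.
have qn : vge w (wval w q) q by rewrite /vge lexx orbT.
move: qv1; rewrite {1}/vge (negPf q0) /=.
have q'B := wchart_tz qn ql.
have q'v : wval w (q * t ^ (- wval w q)) = 0.
  by rewrite (wvalM w q0 (tz_neq0 _)) wval_tz subrr.
move: (q * _) q'B q'v (mulf_neq0 q0 (tz_neq0 (- wval w q))) => q' q'B q'v q'0.
case: (wval w q) => // n _.
have nQq' : ~ Q q' by move=> /QP[_]; rewrite /vge (negPf q'0) q'v.
have tnB m : wchart (t ^+ m).
  by split; [exact: (vgeW (le0z_nat m) (vge_tz m))|exact: (laurent_tz m)].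
have Qtn m : Q (t ^+ m) -> Q t.
  elim: m => [|m IH]; first by rewrite expr0 => /Q1.
  by rewrite exprS => /(Qx _ _ tB (tnB m))[//|/IH].
by move=> /(Qx _ _ q'B (tnB n))[/nQq'|/Qtn].
Qed.

Definition wdivisor : prime_divisor k N :=
  @PrimeDivisor k N wchart
    (ex_intro _ _ (ex_intro _ _ wchart_fg)) wchartF wchart_integrally_closed
    wprime wprime_height_one.

Lemma wdivisor_local_ring : local_ring wdivisor = [set x | vge w 0 x].
Proof.
apply/seteqP; split => [_ [a [b [[a0 _] [b0 bl] bP ->]]]|x x0].
  have b1 : ~~ vge w 1 b by apply/negP => b1; apply: bP.
  have bn0 : b != 0 by apply: contraNneq b1 => ->; rewrite vge0.
  rewrite /= -[X in vge _ X]addr0; apply: vgeM => //.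
  rewrite /vge (wvalV w bn0); move: b0 b1; rewrite /vge (negPf bn0) /=.
  by move: (wval w b) => c; lia.
(* Multiplying numerator and denominator by a power of t brings the denominator to value 0, hence
   outside the prime, and the numerator into the chart. *)
have [f [g [g0 xE]]] := ratfunP x.
have gF0 : g%:F != 0 by rewrite tofrac_eq0.
have gn : vge w (wval w g%:F) g%:F by rewrite /vge lexx orbT.
have gB := wchart_tz gn (laurentF g).
have gv : wval w (g%:F * t ^ (- wval w g%:F)) = 0.
  by rewrite (wvalM w gF0 (tz_neq0 _)) wval_tz subrr.
have g'0 := mulf_neq0 gF0 (tz_neq0 (- wval w g%:F)).
exists (x * (g%:F * t ^ (- wval w g%:F))), (g%:F * t ^ (- wval w g%:F)); split => //.
- split; last first.
    by rewrite xE mulrA (divfK gF0); exact: (laurentM (laurentF f) (laurent_tz _)).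
  by rewrite -[X in vge _ X]addr0; apply: vgeM => //; case: gB.
- by move=> [_]; rewrite /vge (negPf g'0) gv.
- by rewrite mulfK.
Qed.

Lemma wdivisor_local_max : local_max wdivisor = [set x | vge w 1 x].
Proof.
apply/seteqP; split => [_ [a [b [[_ a1] [b0 bl] bP ->]]]|x x1].
  have b1 : ~~ vge w 1 b by apply/negP => b1; apply: bP.
  have bn0 : b != 0 by apply: contraNneq b1 => ->; rewrite vge0.
  rewrite /= -[X in vge _ X]addr0; apply: vgeM => //.
  rewrite /vge (wvalV w bn0); move: b0 b1; rewrite /vge (negPf bn0) /=.
  by move: (wval w b) => c; lia.
have : local_ring wdivisor (x * t ^ (- 1)).
  rewrite wdivisor_local_ring /= -[X in vge _ X](subrr 1).
  exact/vgeM/vge_tz.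
move=> [a [b [aB bB bP xE]]]; exists (a * t), b; split => //.
  split; first by apply: wchartM => //; case: wprime_t.
  by rewrite -[X in vge _ X]add0r; apply: vgeM; [case: aB|case: wprime_t].
by rewrite mulrAC -xE divfK // lmon_neq0.
Qed.

End Generation.
End Chart.

(** * Logarithmic derivatives *)

Fact mul_quotient_rule (K : fieldType) (a a' b b' c c' d d' : K) :
  b != 0 -> d != 0 ->
  ((a' * c + a * c') * (b * d) - a * c * (b' * d + b * d')) / (b * d) ^+ 2 =
  (a' * b - a * b') / b ^+ 2 * (c / d) + a / b * ((c' * d - c * d') / d ^+ 2).
Proof. by move=> b0 d0; field; rewrite b0 d0. Qed.

Fact mulr_leibniz (R : comRingType) (a b c d e : R) :
  a * (b * c + d * e) = a * b * c + d * (a * e).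
Proof. by ring. Qed.

Fact mulr_leibnizB (R : comRingType) (a b c d e : R) :
  a * (b * c - d * e) = a * b * c - d * (a * e).
Proof. by ring. Qed.

Section Derivations.
Context (k : fieldType) (N : nat).
Implicit Types (f g : {mpoly k[N]}) (x y : ratfun k N) (j : 'I_N).

Local Notation Xf i := (('X_i : {mpoly k[N]})%:F).

Lemma fpartialM j x y : fpartial j (x * y) = fpartial j x * y + x * fpartial j y.
Proof.
have [a [b [b0 ->]]] := ratfunP x; have [c [d [d0 ->]]] := ratfunP y.
rewrite mulf_div -!tofracM (fpartialE j _ (mulf_neq0 b0 d0)).
rewrite (fpartialE j a b0) (fpartialE j c d0) !mderivM.
have bF : b%:F != 0 by rewrite tofrac_eq0.
have dF : d%:F != 0 by rewrite tofrac_eq0.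
rewrite !(tofracB, tofracM, tofracD, tofracXn).
exact: (mul_quotient_rule _ _ _ _ _ _ bF dF).
Qed.

Lemma fpartialF j f : fpartial j f%:F = (f^`M(j))%:F.
Proof.
rewrite -[f%:F]divr1 -tofrac1 (fpartialE j f (oner_neq0 _)).
by rewrite expr1n mulr1 -[1]/(mpolyC N 1) mderivC mulr0 subr0 tofrac1 divr1.
Qed.

(** The operator X_j d/dX_j is diagonal on monomials, so unlike d/dX_j alone it preserves the
    grading by weight. *)
Lemma mcoeff_euler j f u : ('X_j * f^`M(j))@_u = f@_u *+ u j.
Proof.
elim/mpolyind: f => [|c m p _ _ IH]; first by rewrite mderiv0 mulr0 mcoeff0 mul0rn.
rewrite mderivD mulrDr !mcoeffD IH mulrnDl; congr (_ + _).
rewrite mderivZ -scalerAr !mcoeffZ -mulrnAr mderivX; congr (_ * _).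
have [mj|mj] := eqVneq (m j) 0%N.
  rewrite mj scale0r mulr0 mcoeff0 mcoeffX; case: eqP => [<-|]; last by rewrite mul0rn.
  by rewrite mj.
rewrite -scalerAr -mpolyXD addmC submK ?lep1mP // mcoeffZ mcoeffX.
by case: eqP => [<-|_]; rewrite ?mulr1 ?mulr0 ?mul0rn.
Qed.

Definition dlog j x c := Xf j * fpartial j x = c * x.

Lemma dlogM j x y c d : dlog j x c -> dlog j y d -> dlog j (x * y) (c + d).
Proof.
rewrite /dlog => xc yd; rewrite fpartialM mulr_leibniz xc yd.
by rewrite mulrDl mulrA [x * (d * y)]mulrCA.
Qed.

Lemma dlog1 j : dlog j 1 0.
Proof.
rewrite /dlog -{1}(tofrac1 {mpoly k[N]}) fpartialF -[1]/(mpolyC N 1) mderivC.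
by rewrite tofrac0 mulr0 mul0r.
Qed.

Lemma dlogV j x c : x != 0 -> dlog j x c -> dlog j x^-1 (- c).
Proof.
move=> x0 xc; have := dlog1 j; rewrite /dlog -{1}(divff x0) fpartialM mulr_leibniz xc.
rewrite mul0r (mulfK x0) => /eqP; rewrite addrC addr_eq0 => /eqP E.
by apply: (mulfI x0); rewrite E mulrCA (mulfV x0) mulr1.
Qed.

Lemma dlogXz j x c (n : int) : x != 0 -> dlog j x c -> dlog j (x ^ n) (n%:~R * c).
Proof.
move=> x0 xc.
have dn y d (m : nat) : dlog j y d -> dlog j (y ^+ m) (m%:R * d).
  move=> yd; elim: m => [|m IH]; first by rewrite mul0r; exact: dlog1.
  by rewrite exprS -[m.+1]add1n natrD mulrDl mul1r; exact: dlogM.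
case: n => n; first exact: dn.
rewrite NegzE -exprz_inv mulrNz mulNr -mulrN.
exact/dn/dlogV.
Qed.

Lemma dlog_lmon j (u : 'I_N -> int) : dlog j (lmon k u) (u j)%:~R.
Proof.
rewrite /lmon; have -> : (u j)%:~R = \sum_i (u i)%:~R * (i == j)%:R :> ratfun k N.
  rewrite (bigD1 j) //= eqxx mulr1 big1 ?addr0 // => i /negPf ->.
  by rewrite mulr0.
elim/big_rec2: _ => [|i a b _ IH]; first exact: dlog1.
apply: dlogM IH; apply: dlogXz; first exact: XF_neq0.
rewrite /dlog fpartialF mderivX mnm1E; case: eqP => [->|_]; last first.
  by rewrite scale0r tofrac0 mulr0 mul0r.
rewrite scale1r (_ : (U_(j) - U_(j))%MM = 0%MM) ?mpolyX0 ?tofrac1 1?mulrC //.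
by apply/mnmP => l; rewrite mnmBE subnn mnm0E.
Qed.

Section Weights.
Context (w : 'I_N -> nat).

Lemma coef_grade_euler j f n i :
  (forall i, (i < n)%N -> (grade k w f)`_i = 0) -> (i < n)%N ->
  (grade k w ('X_j * f^`M(j)))`_i = 0.
Proof.
move=> fn iltn; apply/mpolyP => u; have := congr1 (mcoeff u) (fn _ iltn).
rewrite (coef_grade w f i u).
rewrite (coef_grade w ('X_j * _) i u).
rewrite (mcoeff_euler j f u).
rewrite mcoeff0.
by case: (wdeg w u == i); rewrite ?mulr0n // !mulr1n => ->; rewrite mul0rn.
Qed.

Lemma coef_grade_mord f i : (i < mord w f)%N -> (grade k w f)`_i = 0.
Proof. by rewrite mordE => /coef_lt_low_deg. Qed.

Lemma euler_frac j f g : g != 0 -> Xf j * fpartial j (f%:F / g%:F) =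
  ('X_j * f^`M(j) * g - f * ('X_j * g^`M(j)))%:F / (g ^+ 2)%:F.
Proof.
move=> g0; rewrite (fpartialE j f g0) mulrA -tofracM mulrBr !mulrA.
by rewrite [f * 'X_j]mulrC.
Qed.

Lemma mord_ge f n : f != 0 -> (forall i, (i < n)%N -> (grade k w f)`_i = 0) ->
  (n <= mord w f)%N.
Proof.
move=> f0 fn; rewrite mordE; apply: leq_low_deg; first by rewrite grade_eq0.
exact: fn.
Qed.

Lemma vge_frac_num n f g h : f != 0 -> g != 0 -> (mord w g <= mord w f)%N ->
  (forall i, (i < n + mord w g + mord w g)%N -> (grade k w h)`_i = 0) ->
  vge w n%:Z (h%:F / (g ^+ 2)%:F).
Proof.
move=> f0 g0 gf hn; rewrite (vge_frac _ _ _ (expf_neq0 2 g0)).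
case: eqVneq => //= h0; rewrite (mordM w g0 g0).
by have := mord_ge h0 hn; move: (mord w g) (mord w h) => a b; lia.
Qed.

(** For x = f/g the quotient rule has a numerator of order at least mord f + mord g, as the operator
    does not lower orders, over a denominator of order 2 mord g. *)
Lemma vge_euler j x : vge w 0 x -> vge w 0 (Xf j * fpartial j x).
Proof.
have [f [g [g0 ->]]] := ratfunP x.
rewrite (vge_frac _ _ _ g0) (euler_frac j f g0); case: (eqVneq f 0) => [-> _|f0].
  by rewrite mderiv0 mulr0 !mul0r subr0 tofrac0 mul0r vge0.
rewrite add0r lez_nat /= => gf; apply: (vge_frac_num f0 g0 gf) => i ilt.
have ilt' : (i < mord w f + mord w g)%N.
  by rewrite (leq_trans ilt) // add0n leq_add2r.
have hf := @coef_grade_mord f; have hg := @coef_grade_mord g.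
rewrite rmorphB coefB.
have hef l : (l < mord w f)%N -> (grade k w ('X_j * f^`M(j)))`_l = 0.
  exact: coef_grade_euler.
have heg l : (l < mord w g)%N -> (grade k w ('X_j * g^`M(j)))`_l = 0.
  exact: coef_grade_euler.
by rewrite (rmorphM _ _ g) (rmorphM _ f) (coefM_lt hef hg ilt')
  (coefM_lt hf heg ilt') subr0.
Qed.

(* The weighted Euler field multiplies a form of weight n by n, so on f/g with
   initial forms of equal weight the leading terms cancel. *)
Lemma vge_weighted_euler x : vge w 0 x ->
  vge w 1 (\sum_j (w j)%:R * (Xf j * fpartial j x)).
Proof.
have [f [g [g0 ->]]] := ratfunP x.
under eq_bigr do rewrite (euler_frac _ f g0) mulrA.
pose W h := \sum_j (w j)%:R * ('X_j * h^`M(j)) : {mpoly k[N]}.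
have WE h i : (grade k w (W h))`_i = (grade k w h)`_i *+ i.
  apply/mpolyP => u; rewrite mcoeffMn !coef_grade /W raddf_sum /=.
  under eq_bigr do rewrite mulr_natl mcoeffMn mcoeff_euler -mulrnA mulnC.
  rewrite sumrMnr -/(wdeg w u) mulrnAC.
  by case: eqP => [->|]; rewrite ?mulr0n ?mul0rn.
have -> : \sum_j (w j)%:R * ('X_j * f^`M(j) * g - f * ('X_j * g^`M(j)))%:F / (g ^+ 2)%:F
  = (W f * g - f * W g)%:F / (g ^+ 2)%:F.
  rewrite -mulr_suml; congr (_ / _); rewrite /W mulr_suml mulr_sumr -sumrB rmorph_sum.
  apply: eq_bigr => j _; rewrite -(rmorph_nat (@FracField.tofrac {mpoly k[N]})) /=.
  by rewrite -tofracM mulr_leibnizB.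
rewrite (vge_frac _ _ _ g0); case: (eqVneq f 0) => [-> _|f0].
  by rewrite /W big1 ?mul0r ?subr0 ?tofrac0 ?mul0r ?vge0 // => j _;
    rewrite mderiv0 !mulr0.
rewrite add0r lez_nat /= => gf; apply: (vge_frac_num (n := 1%N) f0 g0 gf) => i ilt.
have hf := @coef_grade_mord f; have hg := @coef_grade_mord g.
have hWf l : (l < mord w f)%N -> (grade k w (W f))`_l = 0.
  by move=> lf; rewrite WE hf // mul0rn.
have hWg l : (l < mord w g)%N -> (grade k w (W g))`_l = 0.
  by move=> lg; rewrite WE hg // mul0rn.
rewrite rmorphB coefB !rmorphM.
have [ilt'|ige] := ltnP i (mord w f + mord w g).
  by rewrite (coefM_lt hWf hg ilt') (coefM_lt hf hWg ilt') subr0.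
have fg : mord w f = mord w g.
  by apply/eqP; rewrite eqn_leq gf andbT; move: (mord w f) (mord w g) ilt ige => a b; lia.
have -> : i = (mord w f + mord w g)%N.
  by move: fg ilt ige; move: (mord w f) (mord w g) => a b; lia.
rewrite (coefM_low hWf hg) (coefM_low hf hWg) !WE fg.
by rewrite mulrnAl mulrnAr subrr.
Qed.

End Weights.
End Derivations.

(** * Discrepancy and ratio of a monomial divisor *)

Fact intrM_nat (R : comRingType) (z : int) (n : nat) :
  (z * n%:Z)%:~R = z%:~R * n%:R :> R.
Proof. by rewrite intrM [in RHS]pmulrn. Qed.

Section Monomial.
Context (k : fieldType) (N : nat) (w : 'I_N -> nat) (E : prime_divisor k N).
Context (EO : local_ring E = [set x | vge w 0 x]).
Context (EM : local_max E = [set x | vge w 1 x]).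
Context (v : 'I_N -> int) (wv : iweight w v = 1).
Implicit Types (f g : {mpoly k[N]}) (x y t : ratfun k N) (h : 'I_N -> ratfun k N).

Local Notation Xf i := (('X_i : {mpoly k[N]})%:F).

Lemma uniformizer_wval t : is_uniformizer E t -> t != 0 /\ wval w t = 1.
Proof.
rewrite /is_uniformizer EO EM => tE.
have [c c0 cE] : [set c * t | c in [set x | vge w 0 x]] (lmon k v).
  by rewrite -tE /= /vge (wval_t k wv) lexx orbT.
have ct0 : c * t != 0 by rewrite cE lmon_neq0.
have cn0 : c != 0 by apply: contraNneq ct0 => ->; rewrite mul0r.
have t0 : t != 0 by apply: contraNneq ct0 => ->; rewrite mulr0.
split => //.
have : vge w 1 t.
  have : [set x | vge w 1 x] t; last by [].
  by rewrite tE; exists 1; rewrite ?mul1r //= /vge wval1 lexx orbT.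
have := wvalM w cn0 t0; rewrite cE (wval_t k wv).
move: c0; rewrite /= /vge (negPf cn0) (negPf t0) /=.
by move: (wval w c) (wval w t) => a b; lia.
Qed.

Lemma lmon_uniformizer : is_uniformizer E (lmon k v).
Proof.
rewrite /is_uniformizer EO EM; apply/seteqP; split => [x x1|_ [c c0 <-]] /=.
  exists (x * lmon k v ^ (- 1)); last by rewrite exprN1 (divfK (lmon_neq0 k v)).
  by rewrite /= -[X in vge _ X](subrr 1); exact/vgeM/(vge_tz k wv).
by rewrite -[X in vge _ X]add0r; apply: vgeM => //; rewrite /vge (wval_t k wv) lexx orbT.
Qed.

Lemma local_unitP x : is_local_unit E x <-> x != 0 /\ wval w x = 0.
Proof.
rewrite /is_local_unit EO /= /vge; split.
  move=> [x0]; rewrite (wvalV w x0) invr_eq0 (negPf x0) /=.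
  by move: (wval w x) => a; split => //; lia.
by move=> [x0 xv]; rewrite (wvalV w x0) invr_eq0 (negPf x0) xv.
Qed.

Lemma val_wval x : x != 0 -> Defs.val E x = wval w x.
Proof.
move=> x0; apply: xget_unique.
  exists (lmon k v), (x * lmon k v ^ (- wval w x)); split.
  - exact: lmon_uniformizer.
  - apply/local_unitP; split; first exact: (mulf_neq0 x0 (tz_neq0 k v _)).
    by rewrite (wvalM w x0 (tz_neq0 k v _)) (wval_tz k wv) subrr.
  - by rewrite -mulrA -(expfzDr _ _ (lmon_neq0 k v)) addNr expr0z mulr1.
move=> n [t [u [/uniformizer_wval[t0 tv] /local_unitP[u0 uv] ->]]].
have tn0 : t ^ n != 0 by exact: (expfz_neq0 n t0).
by rewrite (wvalM w u0 tn0) uv (wvalXz w n t0) tv mul1r add0r.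
Qed.

Definition wsum : nat := (\sum_i w i)%N.

Lemma allXF_prod : wval w (\prod_(i < N) Xf i) = wsum%:Z /\ \prod_(i < N) Xf i != 0.
Proof.
have [i|p0 ->] := wval_prod w (index_enum 'I_N) (F := fun i => Xf i).
  exact: XF_neq0.
split=> //; rewrite /wsum; elim/big_rec2: _ => // i a b _ ->.
by rewrite PoszD wvalF ?mordX ?wdegU // -msupp_eq0 msuppX.
Qed.

Definition logjac (h : 'I_N -> ratfun k N) :=
  \matrix_(i, j) (Xf j * fpartial j (h i)).

Lemma det_logjac h : \det (logjac h) = jacobian h * \prod_i Xf i.
Proof.
have -> : \prod_i Xf i = \det (diag_mx (\row_j Xf j)).
  by rewrite det_diag; apply: eq_bigr => i _; rewrite mxE.
rewrite /jacobian -det_mulmx; congr (\det _).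
by apply/matrixP => i j; rewrite mul_mx_diag !mxE mulrC.
Qed.

Lemma sum_row : \sum_j (v j)%:~R * (w j)%:R = 1 :> ratfun k N.
Proof.
have := congr1 (fun n : int => n%:~R : ratfun k N) wv.
rewrite /iweight rmorph_sum /= => e; apply: etrans e.
apply: eq_bigr => j _; by rewrite intrM_nat.
Qed.

(** The matrix A = [logjac h] sends the column w into the maximal ideal, by the weighted Euler
    field. Multiplying by the adjugate puts det(A) w_j there for every j, and the relation v.w = 1
    removes the factors w_j, some of which may vanish in k. *)
Lemma vge_det_logjac h : (forall i, vge w 0 (h i)) -> vge w 1 (\det (logjac h)).
Proof.
move=> h0; pose c : 'cV[ratfun k N]_N := \col_j (w j)%:R.
have A0 i j : vge w 0 (logjac h i j) by rewrite mxE vge_euler.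
have cE i : vge w 1 ((logjac h *m c) i 0).
  rewrite mxE; have := vge_weighted_euler (h0 i).
  by congr (vge w 1 _); apply: eq_bigr => j _; rewrite !mxE mulrC.
have dc j : vge w 1 (\det (logjac h) * (w j)%:R).
  have -> : \det (logjac h) * (w j)%:R = (\adj (logjac h) *m (logjac h *m c)) j 0.
    by rewrite mulmxA mul_adj_mx mul_scalar_mx !mxE.
  rewrite mxE; apply: vge_sum => i _; rewrite -[X in vge _ X]add0r; apply: vgeM => //.
  rewrite mxE /cofactor -[X in vge _ X]add0r; apply: vgeM.
    have := vge_int k w ((-1) ^+ (i + j)).
    by rewrite rmorphXn rmorphN1.
  by apply: vge_det => a b; rewrite mxE mxE; exact: A0.
have -> : \det (logjac h) = \sum_j (v j)%:~R * (\det (logjac h) * (w j)%:R).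
  under eq_bigr do rewrite mulrCA.
  rewrite -mulr_sumr -[LHS]mulr1; congr (_ * _).
  by rewrite sum_row.
apply: vge_sum => j _; rewrite -[X in vge _ X]add0r; apply: vgeM => //.
exact: vge_int.
Qed.

(** Passing from logarithmic to ordinary derivatives divides the determinant by the product of the
    variables, whose value is [wsum]. *)
Lemma vge_jacobian h : (forall i, vge w 0 (h i)) ->
  vge w (1 - wsum%:Z) (jacobian h).
Proof.
move=> /vge_det_logjac; rewrite det_logjac /vge.
have [pv p0] := allXF_prod; rewrite mulf_eq0 (negPf p0) orbF.
by case: (eqVneq (jacobian h) 0) => //= j0; rewrite (wvalM w j0 p0) pv lerBlDr.
Qed.

(* The rows v and w_j e_i - w_i e_j (i <> j) span a lattice of index w_j^(N-2),
   so the wedge of the corresponding monomials is nonzero if w_j <> 0 in k. *)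
Definition jac_rows (j : 'I_N) (i : 'I_N) : 'I_N -> int :=
  if i == j then v else koszul w i j.

(** The characteristic cannot divide all entries of w, as v.w = 1 remains true in k. *)
Lemma exists_weight_neq0 : exists j, (w j)%:R != 0 :> ratfun k N.
Proof.
apply: contrapT => nw; have w0 j : (w j)%:R = 0 :> ratfun k N.
  by apply/eqP; apply: contrapT => /negP wj; apply: nw; exists j.
have := sum_row; rewrite big1 => [/eqP|j _]; last by rewrite w0 mulr0.
by rewrite eq_sym oner_eq0.
Qed.

(** A kernel vector x is proportional to w by the Koszul rows, w_j x_i = w_i x_j. Multiplying the
    row equation v.x = 0 by w_j then gives x_j = 0, and so x = 0. *)
Lemma det_jac_rows j : (w j)%:R != 0 :> ratfun k N ->
  \det (\matrix_(i, l) (jac_rows j i l)%:~R : 'M[ratfun k N]_N) != 0.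
Proof.
move=> wj; rewrite -det_tr; apply/negP => /det0P[x /negP x0 xM]; apply: x0.
have xE i : \sum_l x 0 l * (jac_rows j i l)%:~R = 0.
  by have /matrixP/(_ 0 i) := xM; rewrite !mxE; under eq_bigr do rewrite !mxE.
have xi i : (w j)%:R * x 0 i = (w i)%:R * x 0 j.
  have [-> //|ij] := eqVneq i j; apply/eqP; rewrite -subr_eq0; apply/eqP.
  have := xE i; rewrite /jac_rows (negPf ij) /koszul => <-; apply/esym.
  under eq_bigr do rewrite rmorphB !rmorphM /= mulrBr.
  rewrite sumrB (bigD1 i) //= [X in _ - X](bigD1 j) //= !eqxx.
  rewrite big1 => [|l /negPf ->]; last by rewrite !mulr0.
  rewrite big1 => [|l /negPf ->]; last by rewrite !mulr0.
  by rewrite !addr0 !mulr1 ![x _ _ * _]mulrC.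
have xj : x 0 j = 0.
  have := xE j; rewrite /jac_rows eqxx => /(congr1 (fun z => (w j)%:R * z)).
  rewrite mulr0 mulr_sumr; under eq_bigr do rewrite mulrA xi mulrAC.
  rewrite -mulr_suml; under eq_bigr do rewrite mulrC.
  by rewrite sum_row mul1r.
apply/eqP/matrixP => i0 i; rewrite ord1 mxE; apply: (mulfI wj).
by rewrite xi xj !mulr0.
Qed.

Lemma jacobian_lmon (G : 'I_N -> 'I_N -> int) :
  jacobian (fun i => lmon k (G i)) * \prod_i Xf i =
  (\prod_i lmon k (G i)) * \det (\matrix_(i, l) (G i l)%:~R).
Proof.
rewrite -det_logjac.
have -> : \prod_i lmon k (G i) = \det (diag_mx (\row_i lmon k (G i))).
  by rewrite det_diag; apply: eq_bigr => i _; rewrite mxE.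
rewrite -det_mulmx; congr (\det _); apply/matrixP => i j.
rewrite mul_diag_mx !mxE; have := dlog_lmon k j (G i); rewrite /dlog => ->.
exact: mulrC.
Qed.

(** Take X^v, of value 1, and N - 1 Koszul monomials, of value 0. Their logarithmic Jacobian is
    their product times an integer determinant that is nonzero in k, so it has value exactly 1. *)
Lemma exists_canonical_generator : exists g : 'I_N -> ratfun k N,
  [/\ forall i, vge w 0 (g i), jacobian g != 0 & wval w (jacobian g) = 1 - wsum%:Z].
Proof.
have [j wj] := exists_weight_neq0; exists (fun i => lmon k (jac_rows j i)).
have rw i : iweight w (jac_rows j i) = (i == j)%:Z.
  by rewrite /jac_rows; case: eqP => // _; rewrite iweight_koszul.
have := jacobian_lmon (jac_rows j); have [pv p0] := allXF_prod.
have d0 := det_jac_rows wj.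
have [l0 lv] := wval_prod w (index_enum 'I_N) (fun i => lmon_neq0 k (jac_rows j i)).
have dv : wval w (\det (\matrix_(i, l) (jac_rows j i l)%:~R) : ratfun k N) = 0.
  have E1 : \matrix_(i, l) (jac_rows j i l)%:~R =
    map_mx intr (\matrix_(i, l) jac_rows j i l) :> 'M[ratfun k N]_N.
    by apply/matrixP => i l; rewrite !mxE.
  by move: d0; rewrite E1 det_map_mx; exact: wval_int.
move=> jE; have j0 : jacobian (fun i => lmon k (jac_rows j i)) != 0.
  have := mulf_neq0 l0 d0; rewrite -jE; apply: contraNneq => ->.
  by rewrite mul0r.
split => // [i|].
  by rewrite /vge wval_lmon rw; apply/orP; right.
apply/eqP; rewrite eq_sym subr_eq -pv -(wvalM w j0 p0) jE (wvalM w l0 d0) dv addr0 lv.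
under eq_bigr do rewrite wval_lmon rw.
by rewrite (bigD1 j) //= eqxx big1 // => i /negPf ->.
Qed.

Lemma discrepancy_wsum : discrepancy E = wsum%:Z - 1.
Proof.
have [g [g0 j0 jv]] := exists_canonical_generator.
have gC : generates_canonical E g.
  split => // [i|h hO]; first by rewrite EO; exact: g0.
  exists (jacobian h / jacobian g); last by rewrite (divfK j0).
  rewrite EO /= -(subrr (1 - wsum%:Z)); apply: vgeM.
    by apply: vge_jacobian => i; have := hO i; rewrite EO.
  by rewrite /vge (wvalV w j0) jv lexx orbT.
have gv : wsum%:Z - 1 = Defs.val E (jacobian g)^-1.
  by rewrite val_wval ?invr_eq0 // (wvalV w j0) jv opprB.
apply: xget_unique; first by exists g.
move=> n [g' [g'O j'0 g'E] ->]; rewrite val_wval ?invr_eq0 // (wvalV w j'0).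
have : vge w (1 - wsum%:Z) (jacobian g').
  by apply: vge_jacobian => i; have := g'O i; rewrite EO.
(* The other generator also divides [jacobian g]; together with the lower bound this makes the two
   values equal. *)
have [|c] := g'E g; first by case: gC.
rewrite EO /= => c0 cE; have cn0 : c != 0.
  by apply: contraNneq j0 => c00; rewrite cE c00 mul0r.
move: c0 jv; rewrite cE (wvalM w cn0 j'0) /vge (negPf cn0) (negPf j'0) /=.
by move: (wval w c) (wval w (jacobian g')) => a b; lia.
Qed.

Lemma ideal_val_mord (a : set {mpoly k[N]}) : (exists2 f, a f & f != 0) ->
  exists n : nat, [/\ ideal_val E a = n,
    exists f, [/\ a f, f != 0 & mord w f = n] &
    forall f, a f -> f != 0 -> (n <= mord w f)%N].
Proof.
move=> [f0 af0 f00].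
have fv f : f != 0 -> Defs.val E f%:F = (mord w f)%:Z.
  by move=> fn0; rewrite val_wval ?tofrac_eq0 // wvalF.
have ex : exists n : nat, `[< exists f, [/\ a f, f != 0 & mord w f = n] >].
  by exists (mord w f0); apply/asboolP; exists f0.
case: (ex_minnP ex) => n /asboolP[f [af fn0 fn]] nmin.
have nmin' g : a g -> g != 0 -> (n <= mord w g)%N.
  by move=> ag gn0; apply: nmin; apply/asboolP; exists g.
exists n; split => //; last by exists f.
apply: xget_unique.
  split; first by exists f => //; rewrite fv // fn.
  by move=> _ [g [ag gn0] <-]; rewrite fv // lez_nat nmin'.
move=> m [[g [ag gn0] <-] gmin]; rewrite fv //; apply/eqP; rewrite eq_le.
apply/andP; split; last by rewrite lez_nat nmin'.
by rewrite -fn -(fv f fn0) -(fv g gn0); apply: gmin; exists f.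
Qed.

(** Only the local ring of [E] and the primitivity of w enter, so this serves both the divisor built
    from the optimal weight and an arbitrary toric divisor of finite ratio. *)
Lemma lct_ratio_monomial (R : realType) (a : set {mpoly k[N]}) :
  (exists2 f, a f & f != 0) -> exists n : nat,
  [/\ lct_ratio R E a = (if n == 0%N then +oo else (wsum%:R / n%:R)%:E)%E,
    exists f, [/\ a f, f != 0 & mord w f = n] &
    forall f, a f -> f != 0 -> (n <= mord w f)%N].
Proof.
move=> /ideal_val_mord[n [nE nf nmin]]; exists n; split => //.
rewrite /lct_ratio nE discrepancy_wsum subrK.
by rewrite eqz_nat.
Qed.

End Monomial.

(** * Toric divisors *)

Fact mulf_div3 (K : fieldType) (a b c d e : K) :
  a * b / (c * d * e) = a / c * (b / d) / e.
Proof. by rewrite !invfM; ring. Qed.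

Fact mulfVX2K (K : fieldType) (a b : K) : a != 0 -> a * b / a ^+ 2 * a = b.
Proof. by move=> a0; field. Qed.

Section Toric.
Context (k : fieldType) (N : nat) (E : prime_divisor k N).
Implicit Types (x y t : ratfun k N).

Local Notation O := (local_ring E).
Local Notation M := (local_max E).

Lemma div_prime0 : div_prime E 0.
Proof. by have [[[_ P0 _ _] _ _] _ _] := div_primeP E. Qed.

Lemma notin_prime_neq0 x : ~ div_prime E x -> x != 0.
Proof. by move=> xP; apply/eqP => x0; apply: xP; rewrite x0; exact: div_prime0. Qed.

Lemma chart1 : chart E 1.
Proof. by rewrite -(tofrac1 {mpoly k[N]}); exact: chart_over. Qed.

Lemma local_ring0 : O 0.
Proof. by rewrite -(tofrac0 {mpoly k[N]}); exact: local_ring_poly. Qed.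

Lemma local_ring1 : O 1.
Proof. by rewrite -(tofrac1 {mpoly k[N]}); exact: local_ring_poly. Qed.

Lemma chartM x y : chart E x -> chart E y -> chart E (x * y).
Proof. by have [n [g ->]] := chart_fg E; exact: generated_byM. Qed.

Lemma chartD x y : chart E x -> chart E y -> chart E (x + y).
Proof.
have [n [g ->]] := chart_fg E; move=> [p _ <-] [q _ <-]; exists (p + q) => //.
exact: (rmorphD (mmap (@FracField.tofrac _ \o @mpolyC N k) _)).
Qed.

Lemma local_ring_max x : M x -> O x.
Proof.
have [[[PB _ _ _] _ _] _ _] := div_primeP E.
by move=> [a [b [aP bB bP ->]]]; exists a, b; split => //; exact: PB.
Qed.

Lemma local_ring_chart x : chart E x -> O x.
Proof.
move=> xB; exists x, 1; rewrite divr1; split => //.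
  exact: chart1.
by have [[_ P1 _] _ _] := div_primeP E.
Qed.

Lemma local_max_chart x : chart E x -> M x -> div_prime E x.
Proof.
have [[[PB _ _ _] _ Pp] _ _] := div_primeP E.
move=> xB [a [b [aP bB bP xE]]].
have b0 := notin_prime_neq0 bP.
have : div_prime E (x * b) by rewrite xE (divfK b0).
by move/(Pp _ _ xB bB) => [].
Qed.

Lemma local_unit_notin x : x != 0 -> O x -> ~ M x -> is_local_unit E x.
Proof.
move=> x0 Ox; have [a [b [aB bB bP xE]]] := Ox; move=> xM.
split => //; exists b, a; split => //; last by rewrite xE invf_div.
by move=> aP; apply: xM; exists a, b.
Qed.

Lemma local_ring_add x y : O x -> O y -> O (x + y).
Proof.
have [[_ _ Pp] _ _] := div_primeP E.
move=> [a [b [aB bB bP ->]]] [c [d [cB dB dP ->]]].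
exists (a * d + c * b), (b * d); split.
- by apply: chartD; exact: chartM.
- exact: chartM.
- by move/(Pp _ _ bB dB) => [].
- by rewrite (addf_div _ _ (notin_prime_neq0 bP) (notin_prime_neq0 dP)).
Qed.

Section Uniformizer.
Context (t : ratfun k N) (tU : is_uniformizer E t).

Lemma uniformizer_max : M t.
Proof.
rewrite tU; exists 1; last by rewrite mul1r.
exact: local_ring1.
Qed.

Lemma uniformizer_neq0 : t != 0.
Proof.
have [_ P0 _] := div_primeP E; apply/eqP => t0; apply: P0.
apply/seteqP; split => [x Px|_ ->]; last exact: div_prime0.
have : M x.
  exists x, 1; rewrite divr1; split => //.
    exact: chart1.
  by have [[_ P1 _] _ _] := div_primeP E.
by rewrite tU => -[c _ <-]; rewrite t0 mulr0.
Qed.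

Let t0 := uniformizer_neq0.

Lemma uniformizer_inv : ~ O t^-1.
Proof.
move=> Ot; apply: (@not_local_max1 _ _ E); rewrite tU.
by exists t^-1 => //; rewrite mulVf.
Qed.

Lemma local_unitM x y : is_local_unit E x -> is_local_unit E y -> is_local_unit E (x * y).
Proof.
move=> [x0 Ox Ox'] [y0 Oy Oy']; split; first exact: (mulf_neq0 x0 y0).
  exact: local_ringM.
by rewrite invfM; exact: local_ringM.
Qed.

(** At the last power of t dividing x in O the quotient lies outside tO = M, hence is a unit. *)
Lemma has_val_or x : O x -> (forall n : nat, O (x / t ^+ n)) \/
  exists n : nat, is_local_unit E (x / t ^+ n).
Proof.
move=> Ox; have [H|H] := pselect (forall n : nat, O (x / t ^+ n)); [by left|right].
have ex : exists n : nat, `[< ~ O (x / t ^+ n) >].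
  apply: contrapT => nex; apply: H => n; apply: contrapT => On.
  by apply: nex; exists n; apply/asboolP.
case: (ex_minnP ex) => -[|n] /asboolP nO nmin.
  by case: nO; rewrite expr0 divr1.
have On : O (x / t ^+ n).
  apply: contrapT => nOn; have : (n.+1 <= n)%N by apply: nmin; apply/asboolP.
  by rewrite ltnn.
have x0 : x != 0.
  by apply/eqP => x0; apply: nO; rewrite x0 mul0r; exact: local_ring0.
have tn0 : (t ^+ n)^-1 != 0 by rewrite invr_eq0 (expf_neq0 n t0).
exists n; apply: (local_unit_notin (mulf_neq0 x0 tn0) On).
rewrite tU => -[c Oc cE]; apply: nO.
suff -> : x / t ^+ n.+1 = c by [].
by rewrite exprS invfM mulrCA -cE mulrC (mulfK t0).
Qed.

(* The elements divisible by all powers of t form a prime ideal strictly inside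
   the height one prime of E, hence vanish. *)
Lemma divisible_eq0 x : chart E x -> (forall n : nat, O (x / t ^+ n)) -> x = 0.
Proof.
have [[[PB P0 PD PM] P1 Pp] _ Pmin] := div_primeP E.
pose Q := [set x | chart E x /\ forall n : nat, O (x / t ^+ n)].
have Qprime : is_prime (chart E) Q.
  split; first split.
  - by move=> y [].
  - split; first exact: PB.
    by move=> n; rewrite mul0r; exact: local_ring0.
  - move=> y z [yB yn] [zB zn]; split; first exact: chartD.
    by move=> n; rewrite mulrDl; exact: local_ring_add.
  - move=> b y bB [yB yn]; split; first exact: chartM.
    by move=> n; rewrite -mulrA; apply: local_ringM => //; exact: local_ring_chart.
  - move=> [_ /(_ 1%N)]; rewrite expr1 mul1r; exact: uniformizer_inv.
  - move=> y z yB zB [_ yz].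
    have [yn|[n yu]] := has_val_or (local_ring_chart yB); first by left.
    have [zn|[m zu]] := has_val_or (local_ring_chart zB); first by right.
    exfalso; have [yz0 Oyz Oyz'] := local_unitM yu zu.
    apply: uniformizer_inv.
    have -> : t^-1 = (y / t ^+ n * (z / t ^+ m))^-1 * (y * z / t ^+ (n + m).+1).
      by rewrite exprSr exprD mulf_div3 (mulKf yz0).
    exact: local_ringM.
have QP : Q `<=` div_prime E.
  move=> y [yB /(_ 1%N) yn]; apply: local_max_chart => //.
  by rewrite tU; exists (y / t ^+ 1); rewrite ?expr1 ?(divfK t0).
have [Q0|QE] := Pmin Q Qprime QP.
  move=> xB xn; have : Q x by split.
  by rewrite Q0.
(* Strictness: if t = a/b had its numerator divisible by t^2, then b = a/t would lie in the maximal
   ideal. *)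
exfalso; have [a [b [aP bB bP tE]]] := uniformizer_max.
have b0 := notin_prime_neq0 bP.
have [_ /(_ 2%N) aO] : Q a by rewrite QE.
apply: bP; apply: local_max_chart => //.
rewrite tU; exists (a / t ^+ 2) => //.
have -> : a = t * b by rewrite tE (divfK b0).
by rewrite (mulfVX2K b t0).
Qed.

Lemma has_val_local x : x != 0 -> O x -> exists n, has_val E x n.
Proof.
move=> x0 [a [b [aB bB bP xE]]].
have b0 := notin_prime_neq0 bP.
have a0 : a != 0 by apply: contraNneq x0 => a0; rewrite xE a0 mul0r.
have [an|[n au]] := has_val_or (local_ring_chart aB).
  by rewrite (divisible_eq0 aB an) eqxx in a0.
have bu : is_local_unit E b^-1.
  have [] : is_local_unit E b; last first.
    by move=> b1 b2 b3; split; rewrite ?invrK ?invr_eq0.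
  apply: (local_unit_notin b0 (local_ring_chart bB)).
  by move/(local_max_chart bB).
exists n%:Z, t, (a / t ^+ n * b^-1); split; [exact: tU|exact: (local_unitM au bu)|].
by rewrite xE mulrAC -[t ^ _]/(t ^+ n) (mulfVK (expf_neq0 n t0)).
Qed.

End Uniformizer.
End Toric.

(** * Toric divisors have monomial local rings *)

Section Toric.
Context (k : fieldType) (N : nat) (E : prime_divisor k N).
Implicit Types (x y t u : ratfun k N) (f g : {mpoly k[N]}).

Local Notation O := (local_ring E).
Local Notation M := (local_max E).

Lemma local_unitV u : is_local_unit E u -> is_local_unit E u^-1.
Proof. by move=> [u0 Ou Ou']; split; rewrite ?invr_eq0 ?invrK. Qed.

Lemma local_unit1 : is_local_unit E 1.
Proof. by split; rewrite ?invr1 ?oner_neq0 //; exact: local_ring1. Qed.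

Lemma local_unitXz u (n : int) : is_local_unit E u -> is_local_unit E (u ^ n).
Proof.
have X y (m : nat) : is_local_unit E y -> is_local_unit E (y ^+ m).
  move=> yu; elim: m => [|m IH]; first by rewrite expr0; exact: local_unit1.
  by rewrite exprS; exact: (local_unitM yu IH).
move=> uu; case: n => n; first exact: (X u n uu).
by rewrite NegzE -exprz_inv; exact: (X _ _ (local_unitV uu)).
Qed.

Section Uniformizer.
Context (t : ratfun k N) (tU : is_uniformizer E t).
Let t0 := uniformizer_neq0 tU.

(** Two uniformizers differ by a unit, so every value can be read with the fixed [t]. *)
Lemma has_valP x (n : int) :
  has_val E x n -> exists2 u, is_local_unit E u & x = u * t ^ n.
Proof.
move=> [t' [u [t'U uu xE]]].
have t'0 := uniformizer_neq0 t'U.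
have [c Oc cE] : [set c * t | c in O] t' by rewrite -tU; exact: uniformizer_max.
have [c' Oc' cE'] : [set c * t' | c in O] t by rewrite -t'U; exact: uniformizer_max.
have c0 : c != 0 by apply: contraNneq t'0 => c0; rewrite -cE c0 mul0r.
have cu : is_local_unit E c.
  split => //; suff -> : c^-1 = c' by [].
  apply: (mulfI c0); rewrite (mulfV c0); apply: (mulIf t0).
  by rewrite mul1r mulrAC cE mulrC.
exists (u * c ^ n); first exact: (local_unitM uu (local_unitXz n cu)).
by rewrite xE -cE expfzMl mulrA.
Qed.

Lemma local_ring_unitX u (z : int) : is_local_unit E u ->
  O (u * t ^ z) <-> 0 <= z.
Proof.
move=> uu; have [u0 Ou _] := uu; split=> [Ox|].
  apply: (has_val_ge0 (mulf_neq0 u0 (expfz_neq0 z t0)) Ox).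
  by exists t, u.
case: z => // n _; apply: local_ringM => //.
elim: n => [|n IH]; first by rewrite expr0z; exact: local_ring1.
rewrite -[t ^ _]/(t ^+ n.+1) exprS; apply: local_ringM => //.
exact/local_ring_max/uniformizer_max.
Qed.

Lemma local_max_unitX u (z : int) : is_local_unit E u ->
  M (u * t ^ z) <-> 1 <= z.
Proof.
move=> uu; rewrite -subr_ge0 -(local_ring_unitX (z - 1) uu).
rewrite (expfzDr _ _ t0) exprN1 mulrA tU; split => [[c Oc <-]|Ox].
  by rewrite (mulfK t0).
by exists (u * t ^ z / t) => //; rewrite (divfK t0).
Qed.

End Uniformizer.

Section Weight.
Context (w : 'I_N -> nat).
Context (wE : forall f, f != 0 -> is_least
  [set (\sum_(i < N) w i * u i)%:Z | u in [set` msupp f]] (Defs.val E f%:F)).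

Lemma toric_val f : f != 0 -> Defs.val E f%:F = (mord w f)%:Z.
Proof.
move=> f0; have [[m mf <-] mmin] := wE f0.
have [m' m'f m'E] := mord_attained w f0.
apply/eqP; rewrite eq_le; apply/andP; split.
  by rewrite -m'E -[(wdeg w m')%:Z]/((\sum_(i < N) w i * m' i)%:Z);
    apply: mmin; exists m'.
by rewrite lez_nat; exact: mord_leq.
Qed.

(** Both [ideal_val] and [val] fall back to 0, so a nonzero value comes from a genuine
    factorization, which carries a uniformizer. *)
Lemma toric_uniformizer (a : set {mpoly k[N]}) : ideal_val E a <> 0 ->
  exists t, is_uniformizer E t.
Proof.
rewrite /ideal_val; case: xgetP => // n _ [[f [af f0] <-] _].
rewrite /Defs.val; case: xgetP => // m _ [t [u [tU _ _]]] _.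
by exists t.
Qed.

Context (t : ratfun k N) (tU : is_uniformizer E t).
Let t0 := uniformizer_neq0 tU.

Lemma toric_poly f : f != 0 ->
  exists2 u, is_local_unit E u & f%:F = u * t ^ (mord w f)%:Z.
Proof.
move=> f0; apply: (has_valP tU); rewrite -toric_val //.
have [|n fn] := has_val_local tU _ (local_ring_poly E f).
  by rewrite tofrac_eq0.
by apply: xgetPex; exists n.
Qed.

Lemma toric_wval x : x != 0 ->
  exists2 u, is_local_unit E u & x = u * t ^ (wval w x).
Proof.
have [f [g [g0 ->]]] := ratfunP x; rewrite frac_eq0 // => f0.
have [u uu fE] := toric_poly f0; have [u' uu' gE] := toric_poly g0.
exists (u * u'^-1); first exact: (local_unitM uu (local_unitV uu')).
rewrite (wval_frac w f0 g0) fE gE (expfzDr _ _ t0) invfM mulrACA.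
by rewrite -invr_expz.
Qed.

Lemma toric_local_ring : local_ring E = [set x | vge w 0 x].
Proof.
apply/seteqP; suff H x : local_ring E x <-> vge w 0 x by split=> x /H.
have [->|x0] := eqVneq x 0; first by split => _; [exact: vge0|exact: local_ring0].
have [u uu xE] := toric_wval x0; rewrite {1}xE (local_ring_unitX tU _ uu).
by rewrite /vge (negPf x0).
Qed.

Lemma toric_local_max : local_max E = [set x | vge w 1 x].
Proof.
apply/seteqP; suff H x : local_max E x <-> vge w 1 x by split=> x /H.
have [->|x0] := eqVneq x 0.
  split => _; first exact: vge0.
  by rewrite tU; exists 0; [exact: local_ring0|rewrite mul0r].
have [u uu xE] := toric_wval x0; rewrite {1}xE (local_max_unitX tU _ uu).
by rewrite /vge (negPf x0).
Qed.

(** From t = u t^n with n = [wval w t] and u of value 0 follows n = n^2, and t in the maximal ideal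
    excludes 0. For t = f/g, the vector [v] is the difference of exponents of least weight in f and
    g. *)
Lemma toric_primitive : exists v, iweight w v = 1.
Proof.
have [u uu tE] := toric_wval t0.
have tv : wval w t = 1.
  have [u0 Ou Ou'] := uu; move: (uniformizer_max tU) Ou Ou'.
  rewrite toric_local_ring toric_local_max /= /vge invr_eq0 (wvalV w u0).
  rewrite (negPf u0) (negPf t0) /=; have := congr1 (wval w) tE.
  rewrite (wvalM w u0 (expfz_neq0 _ t0)) (wvalXz w _ t0).
  by move: (wval w u) (wval w t) => a b; nia.
have [f [g [g0 tE']]] := ratfunP t.
have f0 : f != 0 by rewrite -(frac_eq0 f g0) -tE'.
move: tv; rewrite tE' (wval_frac w f0 g0).
have [m mf <-] := mord_attained w f0; have [m' m'g <-] := mord_attained w g0.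
by move=> <-; exists (fun i => (m i)%:Z - (m' i)%:Z); rewrite iweightB !iweight_mnm.
Qed.

End Weight.
End Toric.

(** * Linear programming *)

Section LinearProgramming.
Context (F : realFieldType).

(** A constraint is a coefficient list with a lower bound. Points are functions on [nat], so that
    eliminating a variable does not change their type. *)
Definition satisfies (n : nat) (x : nat -> F) (cb : seq F * F) : bool :=
  cb.2 <= \sum_(i < n) cb.1`_i * x i.

Definition set_var (x : nat -> F) (n : nat) (y : F) : nat -> F :=
  fun i => if i == n then y else x i.

Lemma satisfiesS n x y cb : satisfies n.+1 (set_var x n y) cb =
  (cb.2 <= \sum_(i < n) cb.1`_i * x i + cb.1`_n * y).
Proof.
rewrite /satisfies big_ord_recr /= /set_var eqxx; congr (_ <= _ + _).
by apply: eq_bigr => i _; rewrite ltn_eqF.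
Qed.

Lemma finite_interval (L U : seq F) :
  (forall l u, l \in L -> u \in U -> l <= u) ->
  exists y, (forall l, l \in L -> l <= y) /\ (forall u, u \in U -> y <= u).
Proof.
elim: L => [_|l L IH LU].
  elim: U => [|u U [y [_ yU]]]; first by exists 0.
  exists (Num.min u y); split => // u'; rewrite inE => /orP[/eqP->|/yU yu'].
    by rewrite ge_min lexx.
  by rewrite ge_min yu' orbT.
have [|y [yL yU]] := IH; first by move=> l' u l'L; apply: LU; rewrite inE l'L orbT.
exists (Num.max l y); split => [l'|u uU].
  by rewrite inE le_max => /orP[/eqP->|/yL ->]; rewrite ?lexx ?orbT.
by rewrite ge_max yU // LU // inE eqxx.
Qed.

Lemma fourier_motzkin n (C : seq (seq F * F)) :
  exists C' : seq (seq F * F), forall x,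
    all (satisfies n x) C' <-> exists y, all (satisfies n.+1 (set_var x n y)) C.
Proof.
pose Z := [seq cb <- C | cb.1`_n == 0].
pose P := [seq cb <- C | 0 < cb.1`_n].
pose M := [seq cb <- C | cb.1`_n < 0].
(* A lower bound [p] and an upper bound [m] on variable n are added with the positive multipliers
   -m_n and p_n, which cancel that variable. *)
pose comb (p m : seq F * F) : seq F * F :=
  (mkseq (fun i => p.1`_i * - m.1`_n + m.1`_i * p.1`_n) n, p.2 * - m.1`_n + m.2 * p.1`_n).
have combE x p m : satisfies n x (comb p m) =
  (p.2 * - m.1`_n + m.2 * p.1`_n <= (\sum_(i < n) p.1`_i * x i) * - m.1`_n
                                + (\sum_(i < n) m.1`_i * x i) * p.1`_n).
  rewrite /satisfies /=; congr (_ <= _); rewrite !mulr_suml -big_split /=.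
  by apply: eq_bigr => i _; rewrite nth_mkseq //; ring.
exists (Z ++ [seq comb p m | p <- P, m <- M]) => x; rewrite all_cat; split.
  move=> /andP[/allP ZC /allP PM].
  pose bound (cb : seq F * F) := (cb.2 - \sum_(i < n) cb.1`_i * x i) / cb.1`_n.
  have [|y [yP yM]] := @finite_interval (map bound P) (map bound M).
    move=> _ _ /mapP[p pP ->] /mapP[m mM ->].
    have : satisfies n x (comb p m) by apply: PM; apply/allpairsP; exists (p, m).
    move: pP mM; rewrite !mem_filter => /andP[p0 _] /andP[m0 _]; rewrite combE /bound.
    rewrite ler_pdivrMr // mulrAC ler_ndivlMr //; lra.
  exists y; apply/allP => cb cbC; rewrite satisfiesS.
  have [c0|c0|c0] := ltrgtP (cb.1`_n) 0.
  - have := yM (bound cb); rewrite map_f ?mem_filter ?c0 // => /(_ isT).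
    by rewrite /bound ler_ndivlMr // => h; lra.
  - have := yP (bound cb); rewrite map_f ?mem_filter ?c0 // => /(_ isT).
    by rewrite /bound ler_pdivrMr // => h; lra.
  - rewrite c0 mul0r addr0; apply: ZC.
    by rewrite mem_filter c0 eqxx.
move=> [y /allP yC]; apply/andP; split.
  apply/allP => cb; rewrite mem_filter => /andP[/eqP c0 /yC].
  by rewrite satisfiesS c0 mul0r addr0.
apply/allP => _ /allpairsP[[p m] /= [pP mM ->]]; rewrite combE.
move: pP mM; rewrite !mem_filter => /andP[p0 /yC] + /andP[m0 /yC].
rewrite !satisfiesS => hp hm.
have := ler_wpM2r (ltW p0) hm.
have m0' : 0 <= - m.1`_n by rewrite oppr_ge0 ltW.
have := ler_wpM2r m0' hp.
lra.
Qed.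

Lemma satisfies_ext n x y cb : (forall i, (i < n)%N -> x i = y i) ->
  satisfies n x cb = satisfies n y cb.
Proof.
by move=> xy; rewrite /satisfies; congr (_ <= _); apply: eq_bigr => i _; rewrite xy.
Qed.

Lemma fourier_motzkin_iter m n (C : seq (seq F * F)) :
  exists C' : seq (seq F * F), forall x, all (satisfies m x) C' <->
    exists2 y, (forall i, (i < m)%N -> y i = x i) & all (satisfies (n + m) y) C.
Proof.
elim: n C => [|n IH] C.
  exists C => x; split => [xC|[y yx]]; first by exists x.
  by rewrite (eq_all (fun cb => satisfies_ext cb yx)).
have [C1 C1P] := fourier_motzkin (n + m) C; have [C2 C2P] := IH C1.
exists C2 => x; rewrite C2P; split=> [[y yx /C1P[z zC]]|[y yx yC]].
  exists (set_var y (n + m) z) => // i im.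
  by rewrite /set_var ltn_eqF ?yx // (leq_trans im) // leq_addl.
exists y => //; apply/C1P; exists (y (n + m)%N).
rewrite (eq_all (a2 := satisfies (n + m).+1 y)) // => cb.
by apply: satisfies_ext => i _; rewrite /set_var; case: eqP => [->|].
Qed.

Definition objective (n : nat) (o : seq F) (x : nat -> F) : F :=
  \sum_(i < n) o`_i * x i.

(** Eliminating all variables except the bound on the objective leaves finitely many weak
    inequalities in one unknown. Their least solution exists in [F] itself, without any
    completeness, and lifts back to a point. *)
Lemma linear_program_attained n (C : seq (seq F * F)) (o : seq F) (B : F) :
  (forall x, all (satisfies n x) C -> B <= objective n o x) ->
  (exists x, all (satisfies n x) C) ->
  exists2 x, all (satisfies n x) C &
    forall y, all (satisfies n y) C -> objective n o x <= objective n o y.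
Proof.
move=> BC [x0 x0C].
(* Variable 0 is an upper bound for the objective. *)
pose cons0 (cb : seq F * F) : seq F * F := (0 :: cb.1, cb.2).
pose obj0 : seq F * F := (1 :: mkseq (fun i => - o`_i) n, 0).
pose tl (x : nat -> F) := fun i => x i.+1.
have cons0E x cb : satisfies (n + 1) x (cons0 cb) = satisfies n (tl x) cb.
  by rewrite addn1 /satisfies big_ord_recl /= mul0r add0r.
have obj0E x : satisfies (n + 1) x obj0 = (objective n o (tl x) <= x 0%N).
  rewrite addn1 /satisfies big_ord_recl /= mul1r -lerBlDr sub0r; congr (_ <= _).
  rewrite -sumrN; apply: eq_bigr => i _.
  by rewrite /= nth_mkseq ?ltn_ord //= mulNr opprK.
have [D DP] := fourier_motzkin_iter 1 n (obj0 :: map cons0 C).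
have DE t : all (satisfies 1 (fun=> t)) D <->
    exists2 x, all (satisfies n x) C & objective n o x <= t.
  rewrite DP; split=> [[y yt /= /andP[]]|[x xC xt]].
    rewrite obj0E yt // all_map => yo yC; exists (tl y) => //.
    by rewrite -(eq_all (cons0E y)).
  exists (fun i => if i is j.+1 then x j else t); first by case.
  by rewrite /= obj0E xt all_map (eq_all (cons0E _)).
have sat1 t cb : satisfies 1 (fun=> t) cb = (cb.2 <= cb.1`_0 * t).
  by rewrite /satisfies big_ord1.
pose T := foldr Num.max B [seq cb.2 / cb.1`_0 | cb <- D & 0 < cb.1`_0].
have leT t : (T <= t) =
    (B <= t) && all (fun l => l <= t) [seq cb.2 / cb.1`_0 | cb <- D & 0 < cb.1`_0].
  rewrite /T; elim: [seq _ | _ <- _ & _] => [|l L IH] /=; first by rewrite andbT.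
  by rewrite ge_max IH andbCA.
have Tmin t : all (satisfies 1 (fun=> t)) D -> T <= t.
  move=> tD; rewrite leT; apply/andP; split.
    by have /DE[x /BC Bx xt] := tD; exact: le_trans xt.
  apply/allP => _ /mapP[cb + ->]; rewrite mem_filter => /andP[c0 cD].
  by rewrite ler_pdivrMr // mulrC -sat1 (allP tD).
have t0D : all (satisfies 1 (fun=> objective n o x0)) D by apply/DE; exists x0.
(* Upper bounds hold at T since T is at most a feasible value, lower bounds since T is at least each
   of them. *)
have TD : all (satisfies 1 (fun=> T)) D.
  apply/allP => cb cD; rewrite sat1.
  have := allP t0D _ cD; rewrite sat1; have Tt := Tmin _ t0D.
  have [c0|c0|->] := ltrgtP (cb.1`_0) 0; last by rewrite !mul0r.
  - by move/le_trans; apply; rewrite ler_nM2l.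
  - move=> _; rewrite mulrC -ler_pdivrMr //.
    have := leT T; rewrite lexx => /esym/andP[_ /allP]; apply.
    by apply/mapP; exists cb => //; rewrite mem_filter c0.
have /DE[x xC xT] := TD; exists x => // y yC.
by apply: (le_trans xT); apply: Tmin; apply/DE; exists y.
Qed.

End LinearProgramming.

(** * The optimal weight *)

Section OriginIdeal.
Context (k : fieldType) (N : nat).
Implicit Types (f g : {mpoly k[N]}).

Lemma origin_idealX i : origin_ideal ('X_i : {mpoly k[N]}).
Proof.
exists (fun j => (j == i)%:R) => //.
rewrite (bigD1 i) //= eqxx mul1r big1 ?addr0 // => j /negPf ->.
by rewrite mul0r.
Qed.

Lemma origin_idealP f : origin_ideal f <-> f@_0%MM = 0.
Proof.
split=> [[c _ <-]|f0].
  rewrite raddf_sum big1 //= => i _; rewrite (rmorphM (mcoeff 0%MM)) /=.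
  by rewrite mcoeffX mnm1_eq0 mulr0.
rewrite (mpolyE f) big_seq; apply: (big_ind (@origin_ideal k N)).
- by exists (fun=> 0) => //; rewrite big1 // => i _; rewrite mul0r.
- move=> _ _ [c _ <-] [c' _ <-]; exists (fun i => c i + c' i) => //.
  by rewrite -big_split; apply: eq_bigr => i _; rewrite mulrDl.
move=> u uf; have : u != 0%MM.
  by apply: contraTneq uf => ->; rewrite mcoeff_msupp f0 eqxx.
rewrite -mdeg_eq0 mdegE sum_nat_eq0 negb_forall => /existsP[i /= ui].
have [c _ cE] := origin_idealX i.
exists (fun j => f@_u *: 'X_[u - U_(i)] * c j) => //.
under eq_bigr do rewrite -mulrA.
by rewrite -mulr_sumr cE -scalerAl -mpolyXD submK // lep1mP.
Qed.

End OriginIdeal.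

Lemma bezout_sum (I : eqType) (r : seq I) (z : I -> nat) : uniq r ->
  exists v : I -> int, \sum_(i <- r) v i * (z i)%:Z = (\big[gcdn/0%N]_(i <- r) z i)%:Z.
Proof.
elim: r => [_|i r IH /= /andP[ir /IH[v vE]]].
  by exists (fun=> 0); rewrite !big_nil.
have [a [b ab]] := Bezoutz (z i)%:Z (\big[gcdn/0%N]_(j <- r) z j)%:Z.
exists (fun j => if j == i then a else b * v j).
rewrite !big_cons eqxx; apply: etrans ab; rewrite -vE mulr_sumr; congr (_ + _).
rewrite !big_seq; apply: eq_bigr => j jr; rewrite ifN ?mulrA //.
by apply: contraNneq ir => <-.
Qed.

Lemma common_denominator (n : nat) (x : 'I_n -> rat) : (forall i, 0 <= x i) ->
  exists2 D : nat, (0 < D)%N & exists z : 'I_n -> nat, forall i, (z i)%:R = x i * D%:R.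
Proof.
move=> x0; pose D := (\prod_i `|denq (x i)|)%N; exists D.
  by rewrite prodn_gt0 // => i; rewrite absz_gt0 denq_neq0.
have H i : exists z : nat, z%:R = x i * D%:R.
  exists (`|numq (x i)| * \prod_(j | j != i) `|denq (x j)|)%N.
  have -> : D = (`|denq (x i)| * \prod_(j | j != i) `|denq (x j)|)%N.
    by rewrite /D (bigD1 i).
  rewrite !natrM mulrA; congr (_ * _).
  rewrite !natr_absz (gtr0_norm (denq_gt0 _)) ger0_norm ?numq_ge0 //.
  exact: numqE.
by have [z zE] := choice H; exists z.
Qed.

Lemma primitive_direction (n : nat) (x : 'I_n -> rat) : (forall i, 0 <= x i) ->
  (exists i, x i != 0) ->
  exists (w : 'I_n -> nat) (v : 'I_n -> int) (c : rat),
    [/\ iweight w v = 1, 0 < c & forall i, (w i)%:R = c * x i].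
Proof.
move=> x0 [i0 xi0]; have [D D0 [z zE]] := common_denominator x0.
pose g := (\big[gcdn/0%N]_i z i)%N.
have gz i : (g %| z i)%N by rewrite /g (bigD1 i) //= dvdn_gcdl.
have g0 : (0 < g)%N.
  rewrite lt0n; apply: contraNneq xi0 => gg; have := gz i0.
  rewrite gg dvd0n => /eqP zi0; have := zE i0; rewrite zi0 => /esym/eqP.
  by rewrite mulf_eq0 pnatr_eq0 (gtn_eqF D0) orbF.
have gQ : g%:R != 0 :> rat by rewrite pnatr_eq0 gtn_eqF.
have [v vE] := bezout_sum z (index_enum_uniq 'I_n).
exists (fun i => z i %/ g)%N, v, (D%:R / g%:R); split.
- have gZ : g%:Z != 0 by rewrite eqz_nat gtn_eqF.
  apply: (mulIf gZ); rewrite mul1r -[RHS]vE /iweight mulr_suml.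
  by apply: eq_bigr => i _; rewrite -mulrA -PoszM divnK.
- by rewrite divr_gt0 // ltr0n.
- move=> i; apply: (mulIf gQ); rewrite -natrM divnK // zE.
  by rewrite mulrAC (divfK gQ) mulrC.
Qed.

(** * The linear program of a primary ideal *)

Section Primary.
Context (k : fieldType) (N : nat) (a : set {mpoly k[N]}).
Context (N0 : (0 < N)%N) (ha : primary_to (@origin_ideal k N) a).
Implicit Types (u : 'X_{1..N}).

Definition occurs u : Prop := exists2 f, a f & u \in msupp f.

Lemma occurs_neq0 u : occurs u -> u != 0%MM.
Proof.
have [_ _ _ ra] := ha; move=> [f af uf].
have /origin_idealP f0 : origin_ideal f by rewrite -ra; exists 1%N; rewrite expr1.
by apply: contraTneq uf => ->; rewrite mcoeff_msupp f0 eqxx.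
Qed.

Lemma exists_pure_power : exists d : nat, forall i, occurs (U_(i) *+ d)%MM.
Proof.
have [[_ _ _ aM] _ _ ra] := ha.
have H (i : 'I_N) : exists n : nat, a ('X_i ^+ n).
  by have := origin_idealX k i; rewrite -ra.
have [n nE] := choice H.
exists (\max_i n i)%N => i; exists ('X_i ^+ (\max_i n i)); last first.
  by rewrite mpolyXn msuppX inE.
rewrite -(subnK (leq_bigmax i)) exprD.
by apply: aM => //; exact: nE.
Qed.

(* Exponents outside a box are dominated by a pure power, so only finitely many
   constrain a nonnegative weight. *)
Lemma finite_exponents : exists2 L : seq 'X_{1..N}, (forall u, u \in L -> occurs u) &
  forall (x : 'I_N -> rat) (c : rat), (forall i, 0 <= x i) ->
    (forall u, u \in L -> c <= \sum_i x i * (u i)%:R) ->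
    forall u, occurs u -> c <= \sum_i x i * (u i)%:R.
Proof.
have [d dP] := exists_pure_power.
(* An exponent of degree above N d has an entry at least d, so it dominates the pure power d e_i,
   whose degree d is within the bound. *)
pose L := [seq val m | m <- enum {: 'X_{1..N < (N * d).+1}} & `[< occurs (val m) >]].
have LP u : u \in L <-> (mdeg u < (N * d).+1)%N /\ occurs u.
  split=> [/mapP[m + ->]|[ub uo]].
    by rewrite mem_filter => /andP[/asboolP mo _]; split => //; exact: bmdeg.
  apply/mapP; exists (BMultinom ub) => //.
  by rewrite mem_filter mem_enum andbT; apply/asboolP.
exists L => [u /LP[] //|x c x0 xc u uo].
have [ub|ub] := ltnP (mdeg u) (N * d).+1; first by apply: xc; apply/LP.
have [i di] : exists i, (d <= u i)%N.
  apply: contrapT => nd; move: ub; rewrite ltnNge => /negP; apply.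
  rewrite mdegE -[X in (_ <= X * _)%N]card_ord -sum_nat_const; apply: leq_sum => i _.
  by rewrite ltnW // ltnNge; apply/negP => di; apply: nd; exists i.
have : c <= \sum_j x j * ((U_(i) *+ d)%MM j)%:R.
  by apply/xc/LP; split; rewrite ?mdegMn ?mdeg1 ?mul1n ?ltnS ?leq_pmull.
move=> /le_trans; apply; apply: ler_sum => j _; apply: ler_wpM2l => //.
rewrite ler_nat mulmnE mnm1E; case: eqP => [<-|]; last by rewrite mul0n.
by rewrite mul1n.
Qed.

(** The ratio (sum of w) / val(a) is invariant under scaling; normalizing val(a) to be at least 1
    turns its minimization into a linear program. *)
Lemma optimal_weight : exists2 x : 'I_N -> rat,
  [/\ forall i, 0 <= x i, exists i, x i != 0 &
    forall u, occurs u -> 1 <= \sum_i x i * (u i)%:R] &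
  forall y : 'I_N -> rat, (forall i, 0 <= y i) ->
    (forall u, occurs u -> 1 <= \sum_i y i * (u i)%:R) ->
    \sum_i x i <= \sum_i y i.
Proof.
have [L LO LP] := finite_exponents.
pose cons u : seq rat * rat := (mkseq (fun i => (nth 0%N (u : N.-tuple nat) i)%:R) N, 1).
pose pos (i : 'I_N) : seq rat * rat := (mkseq (fun j => (j == i)%:R) N, 0).
pose C := [seq cons u | u <- L] ++ [seq pos i | i <- index_enum 'I_N].
have consE x u : satisfies N x (cons u) = (1 <= \sum_(i < N) x i * (u i)%:R).
  rewrite /satisfies /=; congr (_ <= _); apply: eq_bigr => i _.
  by rewrite nth_mkseq // mulrC (mnm_nth 0%N).
have posE x i : satisfies N x (pos i) = (0 <= x i).
  rewrite /satisfies /= (bigD1 i) //= nth_mkseq // eqxx mul1r big1 ?addr0 // => j ji.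
  by rewrite nth_mkseq // -[(_ == _ :> nat)]/(j == i) (negPf ji) mul0r.
have CE x : all (satisfies N x) C <-> (forall i : 'I_N, 0 <= x i) /\
    forall u, u \in L -> 1 <= \sum_(i < N) x i * (u i)%:R.
  rewrite all_cat !all_map; split.
    move=> /andP[/allP xL /allP xp]; split=> [i|u uL];
      last by rewrite -consE; exact: (xL _ uL).
    by rewrite -posE; apply: (xp i); exact: mem_index_enum.
  move=> [xp xL]; apply/andP; split.
    by apply/allP => u uL /=; rewrite consE; exact: xL.
  by apply/allP => i _ /=; rewrite posE; exact: xp.
have oE x : objective N (nseq N 1) x = \sum_(i < N) x i.
  by apply: eq_bigr => i _; rewrite nth_nseq ltn_ord mul1r.
have [x||x] := @linear_program_attained rat N C (nseq N 1) 0.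
- by move=> /CE[xp _]; rewrite oE sumr_ge0.
(* The all-ones point is feasible because [a] lies in the ideal of the origin, so occurring
   exponents have degree at least 1. *)
- exists (fun=> 1); apply/CE; split => // u /LO/occurs_neq0 u0.
  under eq_bigr do rewrite mul1r.
  by rewrite -natr_sum -mdegE (ler_nat _ 1) lt0n mdeg_eq0.
move=> /CE[xp xL] xmin; exists (fun i => x i); first split => //.
- have uO := (exists_pure_power); have [d dP] := uO.
  have := LP (fun i => x i) 1 xp xL _ (dP (Ordinal N0)).
  apply: contraPP => nx; rewrite big1 ?ler10 // => i _.
  have -> : x i = 0 by apply: contrapT => /eqP xi; apply: nx; exists i.
  by rewrite mul0r.
- exact: LP.
move=> y yp yL; pose y' n := if insub n is Some i then y i else 0.
have y'E (i : 'I_N) : y' i = y i by rewrite /y' valK.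
have : all (satisfies N y') C.
  apply/CE; split=> [i|u uL]; first by rewrite y'E.
  by under eq_bigr do rewrite y'E; apply/yL/LO.
move/xmin; rewrite !oE => /le_trans; apply.
by under eq_bigr do rewrite y'E.
Qed.

End Primary.

(** A constant term has weight 0, so a polynomial of positive order has none, even if some entries
    of w vanish. *)
Lemma wdivisor_center (k : fieldType) (N : nat) (w : 'I_N -> nat)
  (v : 'I_N -> int) (wv : iweight w v = 1) :
  center_contains_origin (wdivisor k wv).
Proof.
move=> f [_]; rewrite /vge tofrac_eq0; have [-> _|f0 /=] := eqVneq f 0.
  by apply/origin_idealP; rewrite mcoeff0.
rewrite (wvalF w f0) lez_nat => f1; apply/origin_idealP/memN_msupp_eq0.
apply/negP => /(mord_leq w); rewrite leqNgt (_ : wdeg w 0 = 0)%N ?f1 //.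
by rewrite /wdeg big1 // => i _; rewrite mnm0E muln0.
Qed.

Lemma natr_wdeg (N : nat) (w : 'I_N -> nat) (u : 'X_{1..N}) :
  (wdeg w u)%:R = \sum_i (w i)%:R * (u i)%:R :> rat.
Proof. by rewrite natr_sum; apply: eq_bigr => i _; rewrite natrM. Qed.

Lemma natr_wsum (N : nat) (w : 'I_N -> nat) :
  (wsum w)%:R = \sum_i (w i)%:R :> rat.
Proof. exact: natr_sum. Qed.

(** * Comparison of the optimal divisor with toric approximations *)

Section Main.
Context (R : realType) (k : fieldType) (N : nat) (a : set {mpoly k[N]}).
Context (hL : classL R a) (ha : primary_to (@origin_ideal k N) a).

Lemma ratr_lct_ratio (s n : nat) :
  ratr (s%:R / n%:R) = s%:R / n%:R :> R.
Proof. by rewrite rmorphM fmorphV /= !ratr_nat. Qed.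

Lemma occurs_weight (w : 'I_N -> nat) (n : nat) :
  (forall f, a f -> f != 0 -> (n <= mord w f)%N) ->
  forall u, occurs a u -> (n <= wdeg w u)%N.
Proof.
move=> nmin u [f af uf]; apply: leq_trans (mord_leq w uf); apply: nmin => //.
by apply: contraTneq uf => ->; rewrite msupp0.
Qed.

Lemma exists_divisor_computing_lct : exists E : prime_divisor k N, computes_lct R E a.
Proof.
have [N0 _ a0 ta] := hL.
have [x [x0 xn0 xO] xmin] := optimal_weight N0 ha.
have [w [v [c [wv c0 wx]]]] := primitive_direction x0 xn0.
pose T : rat := \sum_i x i.
have T0 : 0 <= T by apply: sumr_ge0.
exists (wdivisor k wv); split; first exact: wdivisor_center.
(* As w is c times the optimum, its entries add up to c T, while feasibility gives every monomial of
   [a] weight at least c. *)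
have ratio_le : (lct_ratio R (wdivisor k wv) a <= (ratr T)%:E)%E.
  have [n [-> [f [af f0 fn]] _]] := lct_ratio_monomial
    (wdivisor_local_ring k wv) (wdivisor_local_max k wv) wv R a0.
  have cn : c <= n%:R.
    have [u uf uE] := mord_attained w f0; rewrite -fn -uE natr_wdeg.
    under eq_bigr do rewrite wx -mulrA.
    rewrite -mulr_sumr ler_peMr ?(ltW c0) // xO //.
    by exists f.
  have n0 : (0 < n)%N by rewrite -(ltr_nat rat) (lt_le_trans c0).
  rewrite gtn_eqF // lee_fin -ratr_lct_ratio ler_rat ler_pdivrMr ?ltr0n //.
  rewrite natr_wsum; under eq_bigr do rewrite wx.
  by rewrite -mulr_sumr mulrC; exact: (ler_wpM2l T0 cn).
(* The weight of a toric divisor divided by its value [n] on [a] is a feasible point whose objective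
   is the ratio. *)
have ratio_ge E : is_toric E -> lct_ratio R E a != +oo%E ->
    exists2 r : R, lct_ratio R E a = r%:E & ratr T <= r.
  move=> [w' w'E] fin.
  have iv0 : ideal_val E a <> 0.
    by move=> iv0; move: fin; rewrite /lct_ratio iv0 eqxx.
  have [t tU] := toric_uniformizer iv0.
  have [v' wv'] := toric_primitive w'E tU.
  have [n [nE _ nmin]] := lct_ratio_monomial
    (toric_local_ring w'E tU) (toric_local_max w'E tU) wv' R a0.
  move: fin; rewrite nE; case: (eqVneq n 0%N) => [_|n0 _]; first by rewrite eqxx.
  exists ((wsum w')%:R / n%:R) => //.
  have nQ : 0 < n%:R :> rat by rewrite ltr0n lt0n.
  rewrite -ratr_lct_ratio ler_rat natr_wsum mulr_suml; apply: xmin => [i|u uO].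
    by rewrite divr_ge0.
  under eq_bigr do rewrite mulrAC.
  rewrite -mulr_suml -natr_wdeg ler_pdivlMr // mul1r ler_nat.
  exact: occurs_weight uO.
have lct_le : (lct R a <= lct_ratio R (wdivisor k wv) a)%E.
  rewrite lct_inf; apply: ereal_inf_lbound; exists (wdivisor k wv) => //.
  exact: wdivisor_center.
apply/eqP; rewrite eq_le lct_le andbT; apply: (le_trans ratio_le).
(* The bound by T excludes a threshold +oo, and no ratio is at distance below 1 from -oo. At a real
   threshold, a toric divisor within e has finite ratio, which gives T <= lct + e. *)
have := le_trans lct_le ratio_le; move: ta; rewrite /toric_approximation.
case: (lct R a) => [l|//|] ta.
- move=> _; rewrite lee_fin; apply/ler_addgt0Pr => e e0.
  have [E Et +] := ta e e0; have [->|fin] := eqVneq (lct_ratio R E a) +oo%E.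
    by rewrite /= ltNge leey.
  have [r -> Tr] := ratio_ge E Et fin.
  rewrite /= lte_fin => re; apply: (le_trans Tr).
  have := le_lt_trans (ler_norm (r - l)) re.
  lra.
- have [E Et +] := ta 1 ltr01; have [->|fin] := eqVneq (lct_ratio R E a) +oo%E.
    by rewrite /= ltNge leey.
  by have [r -> _] := ratio_ge E Et fin.
Qed.

End Main.

Theorem corollary1p12 (R : realType) (k : closedFieldType) (p : nat)
    (hp : p \in [pchar k]) (N : nat) (a : set {mpoly k[N]})
    (hL : classL R a) (ha : primary_to (@origin_ideal k N) a) :
  exists E : prime_divisor k N, computes_lct R E a.
Proof. exact: exists_divisor_computing_lct. Qed.
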